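(* Let $\alpha_n(0)\in(-1,1)$ for all $n\ge0$, let $\mu$ be the (nontrivial, conjugation-symmetric) probability measure on $\partial\mathbb{D}$ with $\alpha_n(\mu)=\alpha_n(0)$, and let $\alpha_n(t)$ solve the Schur flow $\alpha_n'=(1-|\alpha_n|^2)(\alpha_{n+1}-\alpha_{n-1})$, $\alpha_{-1}\equiv-1$. Let $\Theta=\Theta(\mu)$ and let $S=\mathrm{supp}\,\mu\cap\{e^{i\eta}:|\eta|<\Theta\}$. All limits are as $t\to\infty$. (i) If $1\in\sigma_{\mathrm{ess}}(\mu)$, then $\alpha_n(t)\to(-1)^n$ for all $n$. (ii) If $\Theta>0$, $1\notin\mathrm{supp}\,\mu$, and $S$ has $2m$ points ($m\ge0$), written $e^{\pm i\theta_1},\dots,e^{\pm i\theta_m}$ with $0<\theta_1<\cdots<\theta_m<\Theta$, put $N=m+1$, $x_j=\cos\theta_j$ ($1\le j\le m$), $x_N=\cos\Theta$. Then $\alpha_{2n+1}(t)\to-1$ for $n\ge0$, $\alpha_{2n}(t)\to x_{n+1}$ for $0\le n<N$, and $\alpha_{2n}(t)\to x_N$ for $n\ge N-1$. (iii) If $\Theta>0$, $1\notin\mathrm{supp}\,\mu$, and $S$ is infinite, written $e^{\pm i\theta_j}$, $j\ge1$, with $0<\theta_1<\theta_2<\cdots$, put $x_j=\cos\theta_j$. Then $\alpha_{2n+1}(t)\to-1$ and $\alpha_{2n}(t)\to x_{n+1}$ for all $n\ge0$, and $x_j\to\cos\Theta$ as $j\to\infty$. (iv) If $\Theta>0$, $1\in\mathrm{supp}\,\mu$,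 and $S$ has $2m+1$ points, written $1,e^{\pm i\theta_2},\dots,e^{\pm i\theta_{m+1}}$ with $0<\theta_2<\cdots<\theta_{m+1}<\Theta$, put $N=m+1$, $x_j=\cos\theta_{j+1}$ ($1\le j\le m$), $x_N=\cos\Theta$. Then $\alpha_{2n}(t)\to1$ for $n\ge0$, $\alpha_{2n-1}(t)\to-x_n$ for $1\le n<N$, and $\alpha_{2n-1}(t)\to-x_N$ for $n\ge N$. (v) If $\Theta>0$, $1\in\mathrm{supp}\,\mu$, and $S$ is infinite, written $1$ and $e^{\pm i\theta_j}$, $j\ge2$, with $0<\theta_2<\theta_3<\cdots$, put $x_j=\cos\theta_{j+1}$. Then $\alpha_{2n}(t)\to1$ for $n\ge0$, $\alpha_{2n-1}(t)\to-x_n$ for all $n\ge1$, and $x_j\to\cos\Theta$ as $j\to\infty$.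
   Context: Verblunsky coefficients: for a probability measure $\nu$ on $\partial\mathbb{D}$ with monic orthogonal polynomials $\Phi_n(z;\nu)$, $\alpha_n(\nu)=-\overline{\Phi_{n+1}(0;\nu)}$; real sequences in $(-1,1)^\infty$ correspond bijectively to nontrivial probability measures invariant under $z\mapsto\bar z$. $\sigma_{\mathrm{ess}}(\mu)$ is the set of non-isolated points of $\mathrm{supp}\,\mu$, and $\Theta(\mu)=\min\{|\theta|:\theta\in(-\pi,\pi],\ e^{i\theta}\in\sigma_{\mathrm{ess}}(\mu)\}$. The Schur flow has a unique global solution for these initial data. *)

(* Defs.v *)
(* mathcomp 2.5 + mathcomp-analysis 1.16 + real-closed (complex). *)
From HB Require Import structures.
From mathcomp Require Import all_boot all_order all_algebra.
From mathcomp Require Import all_classical all_reals all_analysis.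
From mathcomp Require Import complex.
Import Order.TTheory GRing.Theory Num.Theory.
Import numFieldNormedType.Exports.

Set Implicit Arguments.
Unset Strict Implicit.
Unset Printing Implicit Defensive.

Local Open Scope classical_set_scope.
Local Open Scope ring_scope.

(* The unit circle is viewed inside C = R^2 (pairs (Re z, Im z)); measures on
   the circle are probability measures on (R * R) (Borel = product sigma-algebra)
   concentrated on the circle. *)

Section Defs.
Variable R : realType.

(* e^{i theta} as a point of R^2 *)
Definition circ (th : R) : (R * R)%type := (cos th, sin th).

(* a point of R^2 as a complex number *)
Definition toC (z : (R * R)%type) : R[i] := Complex z.1 z.2.

(* the probability measure mu lives on the unit circle *)
Definition on_circle (mu : probability (R * R)%type R) : Prop :=
  mu [set z | z.1 ^+ 2 + z.2 ^+ 2 != 1] = 0%E.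

(* mu is invariant under complex conjugation z |-> conj z *)
Definition conj_invariant (mu : probability (R * R)%type R) : Prop :=
  forall A : set (R * R)%type, measurable A ->
    mu [set z | A (z.1, - z.2)] = mu A.

(* topological support of mu *)
Definition supp (mu : probability (R * R)%type R) : set (R * R)%type :=
  [set z | forall e : R, 0 < e -> (0 < mu (ball z e))%E].

(* essential support: the non-isolated points of supp mu *)
Definition ess_supp (mu : probability (R * R)%type R) : set (R * R)%type :=
  [set z | supp mu z /\
     forall e : R, 0 < e -> exists w, [/\ supp mu w, w <> z & ball z e w]].

(* Th = Theta(mu) = min { |theta| : theta in (-pi, pi], e^{i theta} in ess_supp } *)
Definition is_Theta (mu : probability (R * R)%type R) (Th : R) : Prop :=
  (exists th : R, [/\ - pi < th <= pi, ess_supp mu (circ th) & `|th| = Th]) /\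
  (forall th : R, - pi < th <= pi -> ess_supp mu (circ th) -> Th <= `|th|).

(* p is a monic orthogonal polynomial of degree n for mu:
   monic, degree n, and <p, z^k>_{L^2(mu)} = \int p(z) conj(z^k) dmu(z) = 0
   for all k < n (real and imaginary parts). *)
Definition monic_OP (mu : probability (R * R)%type R) (n : nat)
    (p : {poly R[i]}) : Prop :=
  [/\ p \is monic, size p = n.+1 &
    forall k : nat, (k < n)%N ->
      (\int[mu]_z (complex.Re (p.[toC z] * ((toC z) ^+ k)^*))%:E = 0)%E /\
      (\int[mu]_z (complex.Im (p.[toC z] * ((toC z) ^+ k)^*))%:E = 0)%E].

(* alpha_n(mu) = a, i.e. a = - conj (Phi_{n+1}(0; mu)) *)
Definition verblunsky_is (mu : probability (R * R)%type R) (n : nat)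
    (a : R[i]) : Prop :=
  exists p : {poly R[i]}, monic_OP mu n.+1 p /\ a = - (p.[0])^*.

(* alpha_{n-1}(t), with the convention alpha_{-1} = -1 *)
Definition prev_coef (a : nat -> R -> R) (n : nat) (t : R) : R :=
  if n is m.+1 then a m t else -1.

(* Schur flow: alpha_n' = (1 - alpha_n^2) (alpha_{n+1} - alpha_{n-1}), all t in R *)
Definition schur_flow (a : nat -> R -> R) : Prop :=
  forall (n : nat) (t : R),
    is_derive t 1 (a n) ((1 - a n t ^+ 2) * (a n.+1 t - prev_coef a n t)).

End Defs.

(* Main.v *)
Require Import Defs.
From HB Require Import structures.
From mathcomp Require Import all_boot all_order all_algebra.
From mathcomp Require Import all_classical all_reals all_analysis.
From mathcomp Require Import complex measurable_realfun ring lra.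
Import Order.TTheory GRing.Theory Num.Theory.
Import numFieldNormedType.Exports.
Local Open Scope classical_set_scope.
Local Open Scope ring_scope.

(** Put [q = 1 - x] with [x = Re z], let [u] be the quantities [volterra a] and
[gamma_n = (-1)^n a_n], so that [u_n = (1 - gamma_n) (1 + gamma_(n-1)) / 2].  The
Schur flow for [a] becomes the Volterra lattice
[u_n' = - 2 u_n (u_(n+1) - u_(n-1))], and the monic polynomials
[S_(n+2) = s S_(n+1) - u_n S_n] in [s = sqrt q] (built at [t = 0] from the
paraorthogonal polynomials [z Phi_n -/+ Phi_n^*] of [mu]) stay orthogonal for
[exp (- 2 t q) mu]: the defects [G_n = int S_(n+2) s^n exp (- 2 t q) dmu] satisfy
the linear system [G_n' = - 2 u_(n+1) G_n - 2 G_(n+1)] with zero initial data and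
geometric bounds in [n], hence vanish.

Let [p_k] be the monic orthogonal polynomial of degree [k] for
[exp (- 2 t q) mu], or for [q exp (- 2 t q) mu].  If the support consists of at
most [k] atoms below [y] and of points [>= y], with at least [k + 1] points below
[y + e] for each [e], then orthogonality makes [p_k] exponentially small at the
atoms and [p_k^2 exp (- 2 t q)] concentrates at [q = y] as [t -> oo].  By the
three-term recurrence the variance about [y] dominates
[(u_(2k) + u_(2k-1) - y)^2 + u_(2k) u_(2k+1)] (indices shifted by one for the
weight [q]), so these expressions tend to [0]; together with [-1 < a_n < 1] the
limits of the [u_n], and then of the [a_n], follow one after the other. *)

Set Implicit Arguments.
Unset Strict Implicit.
Unset Printing Implicit Defensive.

Section RealDerivatives.
Variable R : realType.
Implicit Types (f g : R -> R) (t : R).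

Lemma is_derive_add f g t (df dg : R) : is_derive t 1 f df -> is_derive t 1 g dg ->
  is_derive t 1 (fun s => f s + g s) (df + dg).
Proof. exact: is_deriveD. Qed.

Lemma is_derive_sub f g t (df dg : R) : is_derive t 1 f df -> is_derive t 1 g dg ->
  is_derive t 1 (fun s => f s - g s) (df - dg).
Proof. exact: is_deriveB. Qed.

Lemma is_derive_mul f g t (df dg : R) : is_derive t 1 f df -> is_derive t 1 g dg ->
  is_derive t 1 (fun s => f s * g s) (df * g t + f t * dg).
Proof.
by move=> hf hg; apply: is_derive_eq (is_deriveM hf hg) _; rewrite addrC mulrC.
Qed.

Lemma is_derive_scale c f t (df : R) :
  is_derive t 1 f df -> is_derive t 1 (fun s => c * f s) (c * df).
Proof.
move=> hf; apply: is_derive_eq (is_derive_mul (is_derive_cst c t 1) hf) _.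
by rewrite mul0r add0r.
Qed.

Lemma is_derive_continuous f (df : R -> R) :
  (forall t : R, is_derive t 1 f (df t)) -> continuous f.
Proof.
by move=> h t; apply: differentiable_continuous; apply/derivable1_diffP; case: (h t).
Qed.

Lemma norm_le_of_derive f (df : R -> R) g (dg : R -> R) :
  (forall t : R, is_derive t 1 f (df t)) -> (forall t : R, is_derive t 1 g (dg t)) ->
  f 0 = 0 -> g 0 = 0 -> (forall t, 0 <= t -> `|df t| <= dg t) ->
  forall t, 0 <= t -> `|f t| <= g t.
Proof.
move=> hf hg f0 g0 hle t t0.
have key (h dh : R -> R) : (forall s : R, is_derive s 1 h (dh s)) -> h 0 = 0 ->
    (forall s, 0 <= s -> 0 <= dh s) -> 0 <= h t.
  move=> hh h0 dh0.
  have hc := is_derive_continuous hh.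
  have [//|c] := @MVT_segment R h dh 0 t t0 (fun x _ => hh x).
    exact: continuous_subspaceT.
  rewrite in_itv/= => /andP[c0 _].
  by rewrite h0 !subr0 => ->; rewrite mulr_ge0// dh0.
rewrite ler_norml; apply/andP; split.
- rewrite -subr_ge0 opprK addrC.
  apply: (key (fun s => g s + f s) (fun s => dg s + df s)
    (fun s => is_derive_add (hg s) (hf s))) => [|s s0].
  + by rewrite f0 g0 addr0.
  + by have := hle s s0; rewrite ler_norml => /andP[]; lra.
- rewrite -subr_ge0.
  apply: (key (fun s => g s - f s) (fun s => dg s - df s)
    (fun s => is_derive_sub (hg s) (hf s))) => [|s s0].
  + by rewrite f0 g0 subr0.
  + by have := hle s s0; rewrite ler_norml => /andP[]; lra.
Qed.

Lemma is_derive_exp_coeff_succ c j t :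
  is_derive t 1 (fun s => (c * s) ^+ j.+1 / j.+1`!%:R) (c * ((c * t) ^+ j / j`!%:R)).
Proof.
have h1 : is_derive t 1 (fun s => c * s) c.
  by apply: is_derive_eq (is_derive_scale c (is_derive_id t 1)) _; rewrite mulr1.
have h2 := is_derive_scale (j.+1`!%:R)^-1 (@is_deriveX _ _ _ j.+1 t 1 c h1).
have E : (fun s => (c * s) ^+ j.+1 / j.+1`!%:R) =
    (fun s => (j.+1`!%:R)^-1 * ((fun s => c * s) ^+ j.+1) s).
  by apply/funext => s; rewrite mulrC; congr (_ * _); rewrite exprfctE.
rewrite E; apply: is_derive_eq h2 _.
rewrite /= factS natrM /GRing.scale /= invfM -/(_%:R).
have j0 : (j.+1%:R : R) != 0 by rewrite pnatr_eq0.
have jf : (j`!%:R : R) != 0 by rewrite pnatr_eq0 -lt0n fact_gt0.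
by rewrite !mulrA; field; rewrite jf -(natrD R 1 j) add1n j0.
Qed.

(* Iterating the integrated equation bounds [G n] by [(12 t)^j / j!] times its
   geometric bound, for every [j]. *)
Lemma lattice_ode_unique (u G : nat -> R -> R) K :
  (forall n t, 0 <= u n t <= 2) ->
  (forall n t, is_derive t 1 (G n) (- 2 * u n.+1 t * G n t - 2 * G n.+1 t)) ->
  (forall n, G n 0 = 0) ->
  (forall n t, 0 <= t -> `|G n t| <= K * 4 ^+ n) ->
  forall n t, 0 <= t -> G n t = 0.
Proof.
move=> u02 hG G0 hK n t t0.
have K0 : 0 <= K.
  by have := le_trans (normr_ge0 _) (hK 0%N 0 (lexx _)); rewrite expr0 mulr1.
have bnd j : forall n t, 0 <= t ->
    `|G n t| <= K * 4 ^+ n * ((12 * t) ^+ j / j`!%:R).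
  elim: j => [|j IHj] {}n {t t0}.
    by move=> t t0; rewrite expr0 fact0 divr1 mulr1 hK.
  pose g s := K * 4 ^+ n * ((12 * s) ^+ j.+1 / j.+1`!%:R).
  apply: (@norm_le_of_derive _ _ g _ (hG n)
    (fun s => is_derive_scale _ (is_derive_exp_coeff_succ 12 j s))) => //.
    by rewrite /g mulr0 expr0n mul0r mulr0.
  move=> s s0; set e := (12 * s) ^+ j / j`!%:R.
  have hn := IHj n s s0; have hn1 := IHj n.+1 s s0.
  rewrite -/e in hn hn1; rewrite exprS in hn1.
  have /andP[u0 u2] := u02 n.+1 s.
  apply: le_trans (ler_normB _ _) _.
  rewrite !normrM normrN !(ger0_norm u0) (@ger0_norm _ 2)//.
  set m := K * 4 ^+ n in hn *.
  have -> : m * (12 * e) = 4 * (m * e) + 2 * (K * (4 * 4 ^+ n) * e) by rewrite /m; ring.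
  apply: lerD; last by rewrite ler_pM2l.
  by rewrite -mulrA; have : u n.+1 s * `|G n s| <= 2 * (m * e); [exact: ler_pM|lra].
apply/eqP; rewrite -normr_eq0 eq_le normr_ge0 andbT.
have lim0 : K * 4 ^+ n * ((12 * t) ^+ j / j`!%:R) @[j --> \oo] --> (0 : R).
  rewrite -[X in _ --> X](mulr0 (K * 4 ^+ n)).
  by apply: cvgMr; exact: pi_irrational.exp_fact.
rewrite -(cvg_lim _ lim0)//; apply: limr_ge; first by apply/cvg_ex; exists 0.
by apply: nearW => j; exact: bnd.
Qed.

End RealDerivatives.

Section VolterraLattice.
Variable R : realType.

Definition volterra (a : nat -> R -> R) (n : nat) (t : R) : R :=
  (1 - (-1) ^+ n * a n t) * (1 - (-1) ^+ n * prev_coef a n t) / 2.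

Lemma volterra_itv (a : nat -> R -> R) n t :
  (forall n t, -1 < a n t < 1) -> 0 < volterra a n t < 2.
Proof.
move=> ha.
have key m : -1 < (-1) ^+ n * a m t < 1.
  by have := ha m t; rewrite -signr_odd; case: odd; rewrite ?mulN1r ?mul1r; lra.
have h1 := key n.
have [h2|h2] : (-1 < (-1) ^+ n * prev_coef a n t < 1) \/ (-1) ^+ n * prev_coef a n t = -1.
- case: n key h1 => [|m] key h1; first by right; rewrite expr0 mul1r.
  by left; exact: key.
- rewrite /volterra; move: (_ * a n t) (_ * prev_coef _ _ _) h1 h2 => x y ? ?.
  by apply/andP; split; nra.
- by rewrite /volterra h2; move: (_ * a n t) h1 => x ?; lra.
Qed.

Lemma volterra_flow0 (a : nat -> R -> R) (t : R) : schur_flow a ->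
  is_derive t 1 (volterra a 0) (- 2 * volterra a 0 t * volterra a 1 t).
Proof.
move=> ha.
have h := is_derive_sub (is_derive_cst (1 : R) t 1) (ha 0%N t).
have E : volterra a 0 = (fun s => 1 - a 0%N s).
  by apply/funext => s; rewrite /volterra /= expr0; lra.
rewrite {1}E; apply: is_derive_eq h _.
by rewrite /volterra /= expr0 expr1; field.
Qed.

Lemma volterra_flowS (a : nat -> R -> R) n (t : R) : schur_flow a ->
  is_derive t 1 (volterra a n.+1)
    (- 2 * volterra a n.+1 t * (volterra a n.+2 t - volterra a n t)).
Proof.
move=> ha.
have hs m := is_derive_sub (is_derive_cst (1 : R) t 1)
  (is_derive_scale ((-1) ^+ n.+1) (ha m t)).
have E : volterra a n.+1 = (fun s => 2^-1 *
    ((1 - (-1) ^+ n.+1 * a n.+1 s) * (1 - (-1) ^+ n.+1 * a n s))).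
  by apply/funext => s; rewrite /volterra /= mulrC.
rewrite {1}E.
apply: is_derive_eq (is_derive_scale 2^-1 (is_derive_mul (hs n.+1) (hs n))) _.
rewrite /volterra /= !exprS; set e := (-1) ^+ n.
have e2 : e = 1 \/ e = -1 by rewrite /e -signr_odd; case: odd; [right|left].
by case: e2 => ->; field.
Qed.

(* [renorm u n q] is [s^n S_n(s)] with [q = s^2], where the [S_n] are the monic
   polynomials with [S_(n+2) = s S_(n+1) - u_n S_n]; the factor [s^n] makes it a
   polynomial in [q]. *)
Fixpoint renorm (u : nat -> R) (n : nat) (q : R) : R :=
  match n with
  | 0 => 1
  | m.+1 => match m with
            | 0 => q
            | k.+1 => q * (renorm u m q - u k * renorm u k q)
            end
  end.

Lemma renormSS u n q :
  renorm u n.+2 q = q * (renorm u n.+1 q - u n * renorm u n q).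
Proof. by []. Qed.

Lemma renorm_le u n q : (forall n, 0 <= u n <= 2) -> 0 <= q <= 2 ->
  `|renorm u n q| <= 4 ^+ n.
Proof.
move=> hu /andP[q0 q2].
suff : `|renorm u n q| <= 4 ^+ n /\ `|renorm u n.+1 q| <= 4 ^+ n.+1 by case.
elim: n => [|n [IH1 IH2]].
  by rewrite /= normr1 expr0 expr1; split => //; rewrite ger0_norm//; lra.
split=> //; rewrite renormSS normrM (ger0_norm q0).
have /andP[u0 u2] := hu n.
have : `|renorm u n.+1 q - u n * renorm u n q| <= 4 ^+ n.+1 + 2 * 4 ^+ n.
  apply: le_trans (ler_normB _ _) _; apply: lerD => //.
  by rewrite normrM (ger0_norm u0) ler_pM.
rewrite !exprS; have := exprn_ge0 n (ler0n R 4); set x := `| _ |.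
move: (4 ^+ n) (normr_ge0 (renorm u n.+1 q - u n * renorm u n q)) => y.
rewrite -/x => x0 y0 hx.
by apply: (@le_trans _ _ (2 * x)); [rewrite ler_wpM2r|lra].
Qed.

Lemma renorm_step_le u n q : (forall n, 0 <= u n <= 2) -> 0 <= q <= 2 ->
  `|renorm u n.+1 q - u n * renorm u n q| <= 6 * 4 ^+ n.
Proof.
move=> hu q02; have /andP[u0 u2] := hu n.
have := renorm_le n hu q02; have := renorm_le n.+1 hu q02.
rewrite exprS => h1 h2.
apply: le_trans (ler_normB _ _) _; rewrite normrM (ger0_norm u0).
have : u n * `|renorm u n q| <= 2 * 4 ^+ n by rewrite ler_pM.
lra.
Qed.

Section Flow.
Variable u : nat -> R -> R.
Hypothesis flow0 : forall t : R, is_derive t 1 (u 0) (- 2 * u 0 t * u 1 t).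
Hypothesis flowS : forall n (t : R),
  is_derive t 1 (u n.+1) (- 2 * u n.+1 t * (u n.+2 t - u n t)).
Local Notation rn n t q := (renorm (fun k => u k t) n q).

Lemma is_derive_renorm n (t q : R) : is_derive t 1 (fun s => rn n s q)
  (if n is k.+2 then 2 * u k.+1 t * u k t * q * rn k t q else 0).
Proof.
have fold m : rn m.+2 t q = q * (rn m.+1 t q - u m t * rn m t q) by [].
suff : forall m, (m <= n)%N -> is_derive t 1 (fun s => rn m s q)
  (if m is k.+2 then 2 * u k.+1 t * u k t * q * rn k t q else 0) by apply.
elim: n => [|n IH] m.
  by rewrite leqn0 => /eqP ->; exact: is_derive_cst.
rewrite leq_eqVlt => /orP[/eqP ->|]; last exact: IH.
case: n IH => [_|n IH]; first exact: is_derive_cst.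
have h1 := IH n.+1 (leqnn _); have h0 := IH n (leqnSn _).
have hu : is_derive t 1 (u n) (- 2 * u n t * (u n.+1 t - if n is k.+1 then u k t else 0)).
  by case: n {IH h1 h0 fold} => [|k]; [rewrite subr0|].
apply: is_derive_eq (is_derive_scale q
  (is_derive_sub h1 (is_derive_mul hu h0))) _.
case: n {IH h1 h0 hu} => [|[|k]]; rewrite ?fold /=; ring.
Qed.

Lemma is_derive_renorm_step n (t q : R) :
  is_derive t 1 (fun s => rn n.+1 s q - u n s * rn n s q)
    (2 * u n.+1 t * u n t * rn n t q).
Proof.
have fold m : rn m.+2 t q = q * (rn m.+1 t q - u m t * rn m t q) by [].
have hu : is_derive t 1 (u n) (- 2 * u n t * (u n.+1 t - if n is k.+1 then u k t else 0)).
  by case: n => [|k]; [rewrite subr0|].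
apply: is_derive_eq (is_derive_sub (is_derive_renorm n.+1 t q)
  (is_derive_mul hu (is_derive_renorm n t q))) _.
by case: n {hu} => [|[|k]]; rewrite ?fold /=; ring.
Qed.

End Flow.
End VolterraLattice.

Section BoundedIntegrals.
Context d (T : measurableType d) (R : realType) (mu : probability T R).
Variable D : set T.
Hypothesis mD : measurable D.
Implicit Types f g : T -> R.

Definition bdd_meas (f : T -> R) : Prop :=
  measurable_fun setT f /\ exists C : R, forall z, D z -> `|f z| <= C.

Lemma bdd_meas_integrable f : bdd_meas f -> mu.-integrable D (EFin \o f).
Proof.
move=> [mf [C hC]]; apply: measurable_bounded_integrable => //.
- by apply: le_lt_trans (probability_le1 mu mD) _; rewrite ltry.
- exact: measurable_funTS.
- exists C; split; first exact: num_real.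
  by move=> M CM z Dz; exact: le_trans (hC z Dz) (ltW CM).
Qed.

Lemma bdd_meas_cst c : bdd_meas (fun=> c).
Proof. by split; [exact: measurable_cst|exists `|c|]. Qed.

Lemma bdd_measD f g : bdd_meas f -> bdd_meas g -> bdd_meas (fun z => f z + g z).
Proof.
move=> [mf [C hC]] [mg [C' hC']]; split; first exact: measurable_funD.
exists (C + C') => z Dz; apply: le_trans (ler_normD _ _) _.
by apply: lerD; [exact: hC|exact: hC'].
Qed.

Lemma bdd_measM f g : bdd_meas f -> bdd_meas g -> bdd_meas (fun z => f z * g z).
Proof.
move=> [mf [C hC]] [mg [C' hC']]; split; first exact: measurable_funM.
by exists (C * C') => z Dz; rewrite normrM ler_pM// ?hC ?hC'.
Qed.

Lemma bdd_measZ c f : bdd_meas f -> bdd_meas (fun z => c * f z).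
Proof. by apply: bdd_measM; exact: bdd_meas_cst. Qed.

Lemma bdd_measB f g : bdd_meas f -> bdd_meas g -> bdd_meas (fun z => f z - g z).
Proof.
move=> hf hg; have := bdd_measD hf (bdd_measZ (-1) hg).
by congr bdd_meas; apply/funext => z; rewrite mulN1r.
Qed.

Lemma bdd_measX f n : bdd_meas f -> bdd_meas (fun z => f z ^+ n).
Proof.
move=> hf; elim: n => [|n IHn].
  by under eq_fun do rewrite expr0; exact: bdd_meas_cst.
by under eq_fun do rewrite exprS; exact: bdd_measM.
Qed.

Lemma bdd_meas_horner (p : {poly R}) f : bdd_meas f -> bdd_meas (fun z => p.[f z]).
Proof.
move=> hf; elim/poly_ind: p => [|p c IHp].
  by under eq_fun do rewrite horner0; exact: bdd_meas_cst.
under eq_fun do rewrite hornerMXaddC.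
by apply: bdd_measD; [exact: bdd_measM|exact: bdd_meas_cst].
Qed.

Lemma bdd_meas_indic (A : set T) : measurable A -> bdd_meas (\1_A : T -> R).
Proof.
move=> mA; split; first exact: measurable_indic.
exists 1 => z _; rewrite indicE; case: (z \in A); rewrite ?normr1 ?normr0 //.
Qed.

Lemma bdd_intD f g : bdd_meas f -> bdd_meas g ->
  \int[mu]_(z in D) (f z + g z) = \int[mu]_(z in D) f z + \int[mu]_(z in D) g z.
Proof. by move=> hf hg; apply: RintegralD => //; exact: bdd_meas_integrable. Qed.

Lemma bdd_intB f g : bdd_meas f -> bdd_meas g ->
  \int[mu]_(z in D) (f z - g z) = \int[mu]_(z in D) f z - \int[mu]_(z in D) g z.
Proof. by move=> hf hg; apply: RintegralB => //; exact: bdd_meas_integrable. Qed.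

Lemma bdd_intZ c f : bdd_meas f ->
  \int[mu]_(z in D) (c * f z) = c * \int[mu]_(z in D) f z.
Proof. by move=> hf; apply: RintegralZl => //; exact: bdd_meas_integrable. Qed.

Lemma bdd_int_le f g : bdd_meas f -> bdd_meas g ->
  (forall z, D z -> f z <= g z) -> \int[mu]_(z in D) f z <= \int[mu]_(z in D) g z.
Proof.
by move=> hf hg fg; apply: le_Rintegral => //; exact: bdd_meas_integrable.
Qed.

Lemma bdd_int_indic (A : set T) c : measurable A ->
  \int[mu]_(z in D) (c * \1_A z) = c * fine (mu (A `&` D)).
Proof.
move=> mA; rewrite bdd_intZ; last exact: bdd_meas_indic.
by congr (_ * _); rewrite /Rintegral integral_indic// setIC.
Qed.

Lemma bdd_int_norm_le f C : bdd_meas f -> 0 <= C ->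
  (forall z, D z -> `|f z| <= C) -> `|\int[mu]_(z in D) f z| <= C.
Proof.
move=> hf C0 hC; apply: le_trans (le_normr_Rintegral _ _) _ => //.
  exact: bdd_meas_integrable.
apply: (@le_trans _ _ (\int[mu]_(z in D) C)).
  apply: le_Rintegral => //.
  - by apply: integrable_norm; exact: bdd_meas_integrable.
  - by apply: bdd_meas_integrable; exact: bdd_meas_cst.
rewrite Rintegral_cst// ler_piMr// -lee_fin fineK; last exact: fin_num_measure.
exact: probability_le1.
Qed.

Lemma is_derive_bdd_int (f df : R -> T -> R) (t : R) :
  (forall s, bdd_meas (f s)) ->
  (forall (s : R) z, D z -> is_derive s 1 (f^~ z) (df s z)) ->
  (exists C : R, forall s z, t - 1 < s < t + 1 -> D z -> `|df s z| <= C) ->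
  is_derive t 1 (fun s => \int[mu]_(z in D) f s z) (\int[mu]_(z in D) df t z).
Proof.
move=> hf hdf [C hC].
have It : `](t - 1), (t + 1)[%classic t by rewrite /= in_itv /=; lra.
have d1 s z : D z -> partial1of2 f s z = df s z.
  by move=> Dz; rewrite partial1of2E; case: (hdf s z Dz).
have h1 : forall s, `](t - 1), (t + 1)[%classic s -> mu.-integrable D (EFin \o f s).
  by move=> s _; exact: bdd_meas_integrable.
have h2 : forall s z, `](t - 1), (t + 1)[%classic s -> D z -> derivable (f^~ z) s 1.
  by move=> s z _ Dz; case: (hdf s z Dz).
have h3 : mu.-integrable D (EFin \o (fun=> `|C|)).
  by apply: bdd_meas_integrable; exact: bdd_meas_cst.
have h4 : forall s z, `](t - 1), (t + 1)[%classic s -> D z -> `|partial1of2 f s z| <= `|C|.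
  move=> s z; rewrite /= in_itv /= => hs Dz; rewrite d1//.
  exact: le_trans (hC s z hs Dz) (ler_norm _).
apply: DeriveDef.
  exact: (@derivable_under_integral R _ T mu f D mD t _ _ It h1 h2 _ (fun=> normr_ge0 C) h3 h4).
rewrite -derive1E.
rewrite (@differentiation_under_integral R _ T mu f D mD t _ _ It h1 h2 _ (fun=> normr_ge0 C) h3 h4).
by apply: eq_Rintegral => z /set_mem Dz; exact: d1.
Qed.

End BoundedIntegrals.

Section SupportFull.
Variables (R : realType) (mu : probability (R * R)%type R).

Lemma measurable_prod_ball (c : (R * R)%type) (r : R) : measurable (ball c r).
Proof.
have -> : ball c r = ball c.1 r `*` ball c.2 r by [].
by apply: measurableX; exact: measurable_realfun.measurable_ball.
Qed.

Lemma setC_supp_negligible : mu.-negligible (~` supp mu).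
Proof.
pose c3 (v : rat * rat * rat) : set (R * R)%type :=
  ball ((ratr v.1.1 : R), (ratr v.1.2 : R)) (ratr v.2 : R).
pose F (n : nat) : set (R * R)%type :=
  if unpickle n is Some v then (if mu (c3 v) == 0%E then c3 v else set0) else set0.
suff sub : ~` supp mu `<=` \bigcup_n F n.
  apply: negligibleS sub _; apply: negligible_bigcup => n; rewrite /F.
  case: unpickle => [v|]; last exact: negligible_set0.
  case: ifPn => [/eqP h|_]; last exact: negligible_set0.
  by apply/negligibleP => //; exact: measurable_prod_ball.
move=> z /existsNP[e /not_implyP[e0 /negP]]; rewrite -leNgt => hz.
suff [v v0 vz] : exists2 v, mu (c3 v) = 0%E & c3 v z.
  by exists (pickle v); [exact: I|rewrite /F pickleK v0 eqxx; exact: vz].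
have e40 : 0 < e / 4 by rewrite divr_gt0.
have near_rat (x : R) : exists q : rat, `|x - ratr q| < e / 4.
  have xe : x < x + e / 4 by rewrite ltrDl.
  have [q] := rat_in_itvoo xe.
  by rewrite in_itv /= => /andP[h1 h2]; exists q; rewrite ltr_norml; lra.
have [q1 h1] := near_rat z.1; have [q2 h2] := near_rat z.2.
have e42 : e / 4 < e / 2 by lra.
have [r] := rat_in_itvoo e42.
rewrite in_itv /= => /andP[r1 r2].
exists (q1, q2, r); rewrite /c3 /=.
  apply/eqP; rewrite eq_le measure_ge0 andbT; apply: le_trans hz.
  apply: le_measure; rewrite ?inE; [exact: measurable_prod_ball..|].
  move=> w [/= w1 w2]; split; rewrite /ball /= in w1 w2 *.
  - rewrite (_ : _ - _ = (z.1 - ratr q1) + (ratr q1 - w.1)); last by ring.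
    by apply: le_lt_trans (ler_normD _ _) _; lra.
  - rewrite (_ : _ - _ = (z.2 - ratr q2) + (ratr q2 - w.2)); last by ring.
    by apply: le_lt_trans (ler_normD _ _) _; lra.
by split; rewrite /ball /= distrC; [exact: lt_trans h1 r1|exact: lt_trans h2 r1].
Qed.

Lemma measurable_circle_compl :
  measurable [set z : (R * R)%type | z.1 ^+ 2 + z.2 ^+ 2 != 1].
Proof.
have mf : measurable_fun setT (fun z : (R * R)%type => z.1 ^+ 2 + z.2 ^+ 2).
  apply: measurable_funD.
  - by apply: measurable_funX; exact: measurable_fst.
  - by apply: measurable_funX; exact: measurable_snd.
have := mf measurableT (~` [set 1]) (measurableC (measurable_set1 1)).
rewrite setTI; congr measurable; apply/seteqP; split => z /=; first by move/eqP.
by move=> h; apply/eqP.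
Qed.

Lemma full_set : on_circle mu -> exists D : set (R * R)%type,
  [/\ measurable D, mu (~` D) = 0%E,
      (forall z, D z -> supp mu z) & (forall z, D z -> z.1 ^+ 2 + z.2 ^+ 2 = 1)].
Proof.
move=> hc.
have [N [mN N0 subN]] := setC_supp_negligible.
exists (~` (N `|` [set z | z.1 ^+ 2 + z.2 ^+ 2 != 1])).
have mU : measurable (N `|` [set z | z.1 ^+ 2 + z.2 ^+ 2 != 1]).
  by apply: measurableU => //; exact: measurable_circle_compl.
split.
- exact: measurableC.
- rewrite setCK; apply/negligibleP => //; apply: negligibleU; first by exists N; split.
  by apply/negligibleP => //; exact: measurable_circle_compl.
- move=> z /not_orP[hz _]; apply: contrapT => hs; exact/hz/subN.
- by move=> z /not_orP[_] /= /negP; rewrite negbK => /eqP.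
Qed.

Lemma supp_circle z : on_circle mu -> supp mu z -> z.1 ^+ 2 + z.2 ^+ 2 = 1.
Proof.
move=> hc hz; apply: contrapT => /eqP hne.
suff [e e0 he] : exists2 e : R, 0 < e &
    ball z e `<=` [set z : (R * R)%type | z.1 ^+ 2 + z.2 ^+ 2 != 1].
  have := hz e e0; rewrite ltNge => /negP; apply.
  rewrite -hc; apply: le_measure => //; rewrite ?inE.
  - exact: measurable_prod_ball.
  - exact: measurable_circle_compl.
have cont : continuous (fun w : (R * R)%type => w.1 * w.1 + w.2 * w.2).
  move=> w.
  have c1 : v.1 @[v --> w] --> w.1 by exact: cvg_fst.
  have c2 : v.2 @[v --> w] --> w.2 by exact: cvg_snd.
  by apply: cvgD; apply: cvgM.
have /(_ _)/nbhs_ballP[|e e0 he] := cont z [set x : R | x != 1].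
  by apply: open_nbhs_nbhs; split; [exact: open_neq|rewrite /= -!expr2].
by exists e => // w /he; rewrite /= -!expr2.
Qed.

End SupportFull.

Section ComplexIntegrals.
Variables (R : realType) (mu : probability (R * R)%type R) (D : set (R * R)%type).
Hypothesis mD : measurable D.
Hypothesis muD : mu (~` D) = 0%E.
Hypothesis Dcirc : forall z, D z -> z.1 ^+ 2 + z.2 ^+ 2 = 1.
Local Notation T := (R * R)%type.
Implicit Types v w : T -> R[i].

Definition cbdd_meas w : Prop :=
  bdd_meas D (fun z => complex.Re (w z)) /\ bdd_meas D (fun z => complex.Im (w z)).

Definition cint w : R[i] :=
  Complex (\int[mu]_(z in D) complex.Re (w z)) (\int[mu]_(z in D) complex.Im (w z)).

Lemma circle_le1 (z : T) : D z -> `|z.1| <= 1 /\ `|z.2| <= 1.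
Proof. by move=> /Dcirc h; rewrite !ler_norml; split; apply/andP; split; nra. Qed.

Lemma toC_conj (z : T) : D z -> toC z * (toC z)^* = 1.
Proof.
move=> /Dcirc h; apply/eqP; rewrite eq_complex /=.
by apply/andP; split; apply/eqP; [rewrite -h|]; ring.
Qed.

Lemma cbdd_cst (c : R[i]) : cbdd_meas (fun=> c).
Proof. by split; exact: bdd_meas_cst. Qed.

Lemma cbddD v w : cbdd_meas v -> cbdd_meas w -> cbdd_meas (fun z => v z + w z).
Proof.
move=> [v1 v2] [w1 w2]; split.
- have := bdd_measD v1 w1; congr bdd_meas; apply/funext => z.
  by case: (v z) (w z) => ? ? [].
- have := bdd_measD v2 w2; congr bdd_meas; apply/funext => z.
  by case: (v z) (w z) => ? ? [].
Qed.

Lemma cbddM v w : cbdd_meas v -> cbdd_meas w -> cbdd_meas (fun z => v z * w z).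
Proof.
move=> [v1 v2] [w1 w2]; split.
- have := bdd_measB (bdd_measM v1 w1) (bdd_measM v2 w2).
  by congr bdd_meas; apply/funext => z; case: (v z) (w z) => ? ? [].
- have := bdd_measD (bdd_measM v1 w2) (bdd_measM v2 w1).
  by congr bdd_meas; apply/funext => z; case: (v z) (w z) => ? ? [].
Qed.

Lemma cbddZ c w : cbdd_meas w -> cbdd_meas (fun z => c * w z).
Proof. by apply: cbddM; exact: cbdd_cst. Qed.

Lemma cbddB v w : cbdd_meas v -> cbdd_meas w -> cbdd_meas (fun z => v z - w z).
Proof.
move=> hv hw; have := cbddD hv (cbddZ (-1) hw).
by congr cbdd_meas; apply/funext => z; rewrite mulN1r.
Qed.

Lemma cbddX w n : cbdd_meas w -> cbdd_meas (fun z => w z ^+ n).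
Proof.
move=> hw; elim: n => [|n IHn].
  by under eq_fun do rewrite expr0; exact: cbdd_cst.
by under eq_fun do rewrite exprS; exact: cbddM.
Qed.

Lemma cbdd_conj w : cbdd_meas w -> cbdd_meas (fun z => (w z)^*).
Proof.
move=> [w1 w2]; split.
- by move: w1; congr bdd_meas; apply/funext => z; case: (w z).
- have := bdd_measZ (-1) w2; congr bdd_meas; apply/funext => z.
  by case: (w z) => ? ? /=; rewrite mulN1r.
Qed.

Lemma cbdd_toC : cbdd_meas (fun z => toC z).
Proof.
split; (split; first by [exact: measurable_fst|exact: measurable_snd]);
  by exists 1 => z /circle_le1[].
Qed.

Lemma cbdd_horner (p : {poly R[i]}) : cbdd_meas (fun z => p.[toC z]).
Proof.
elim/poly_ind: p => [|p c IHp].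
  by under eq_fun do rewrite horner0; exact: cbdd_cst.
under eq_fun do rewrite hornerMXaddC.
by apply: cbddD; [apply: cbddM => //; exact: cbdd_toC|exact: cbdd_cst].
Qed.

Lemma cbdd_conjX k : cbdd_meas (fun z : T => (toC z)^* ^+ k).
Proof. by apply: cbddX; apply: cbdd_conj; exact: cbdd_toC. Qed.

Lemma eq_cint v w : (forall z, D z -> v z = w z) -> cint v = cint w.
Proof.
by move=> h; congr Complex; apply: eq_Rintegral => z /set_mem Dz; rewrite h.
Qed.

Lemma cintD v w : cbdd_meas v -> cbdd_meas w ->
  cint (fun z => v z + w z) = cint v + cint w.
Proof.
move=> [v1 v2] [w1 w2]; rewrite /cint -[RHS]/(Complex (_ + _) (_ + _)).
rewrite -!bdd_intD//; congr Complex; apply: eq_Rintegral => z _;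
  by case: (v z) (w z) => ? ? [].
Qed.

Lemma cintZ c w : cbdd_meas w -> cint (fun z => c * w z) = c * cint w.
Proof.
case: c => x y [w1 w2]; rewrite /cint -[RHS]/(Complex (_ - _) (_ + _)).
rewrite -(bdd_intZ mu mD x w1) -(bdd_intZ mu mD y w2).
rewrite -(bdd_intZ mu mD x w2) -(bdd_intZ mu mD y w1).
rewrite -(bdd_intB mu mD (bdd_measZ x w1) (bdd_measZ y w2)).
rewrite -(bdd_intD mu mD (bdd_measZ x w2) (bdd_measZ y w1)).
by congr Complex; apply: eq_Rintegral => z _; case: (w z).
Qed.

Lemma cintB v w : cbdd_meas v -> cbdd_meas w ->
  cint (fun z => v z - w z) = cint v - cint w.
Proof.
move=> hv hw; rewrite -mulN1r -cintZ// -cintD//; last exact: cbddZ.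
by apply: eq_cint => z _; rewrite mulN1r.
Qed.

Lemma cint_conj w : cbdd_meas w -> cint (fun z => (w z)^*) = (cint w)^*.
Proof.
move=> [w1 w2]; rewrite /cint -[RHS]/(Complex _ (- _)); congr Complex.
  by apply: eq_Rintegral => z _; case: (w z).
rewrite -mulN1r -bdd_intZ//.
by apply: eq_Rintegral => z _; rewrite mulN1r; case: (w z).
Qed.

Lemma cint_re (w : T -> R[i]) (f : T -> R) :
  (forall z, D z -> w z = Complex (f z) 0) -> complex.Re (cint w) = \int[mu]_(z in D) f z.
Proof. by move=> h; apply: eq_Rintegral => z /set_mem Dz; rewrite h. Qed.

(* AM-GM: [|f| <= (s + f^2 / s) / 2] for every [s > 0]. *)
Lemma int_sqr_eq0 (f : T -> R) : bdd_meas D f ->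
  \int[mu]_(z in D) (f z) ^+ 2 <= 0 -> \int[mu]_(z in D) f z = 0.
Proof.
move=> hf h0; apply/eqP; rewrite -normr_eq0 eq_le normr_ge0 andbT.
apply/ler_addgt0Pr => s s0; rewrite add0r.
have key (c : R) : `|c| = 1 -> c * \int[mu]_(z in D) f z <= s.
  move=> c1; rewrite -bdd_intZ//.
  have b2 : bdd_meas D (fun z => s / 2 + (2 * s)^-1 * f z ^+ 2).
    by apply: bdd_measD; [exact: bdd_meas_cst|apply: bdd_measZ; exact: bdd_measX].
  apply: le_trans (bdd_int_le (f := fun z => c * f z) mu mD _ b2 _) _.
  - exact: bdd_measZ.
  - move=> z _.
    have c2 : c ^+ 2 = 1 by rewrite -real_normK ?num_real// c1 expr1n.
    have : 0 <= (2 * s)^-1 * (s - c * f z) ^+ 2.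
      by rewrite mulr_ge0 ?sqr_ge0// invr_ge0; lra.
    rewrite sqrrB exprMn c2 mul1r.
    have -> : (2 * s)^-1 * (s ^+ 2 - s * (c * f z) *+ 2 + f z ^+ 2) =
       s / 2 + (2 * s)^-1 * f z ^+ 2 - c * f z by field; lra.
    by lra.
  rewrite (bdd_intD mu mD (bdd_meas_cst _ (s / 2)) (bdd_measZ _ (bdd_measX 2 hf))).
  rewrite (bdd_intZ mu mD _ (bdd_measX 2 hf)).
  rewrite Rintegral_cst//.
  have m1 : fine (mu D) <= 1.
    rewrite -lee_fin fineK; last exact: fin_num_measure.
    exact: probability_le1.
  have : (2 * s)^-1 * (\int[mu]_(x in D) f x ^+ 2) <= 0.
    by rewrite pmulr_rle0// invr_gt0; lra.
  by nra.
have [h|h] := leP 0 (\int[mu]_(z in D) f z).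
- by rewrite ger0_norm// -[X in X <= _]mul1r key// normr1.
- by rewrite ltr0_norm// -mulN1r key// normrN normr1.
Qed.

Lemma cint_sqr_eq0 w : cbdd_meas w -> cint (fun z => w z * (w z)^*) = 0 -> cint w = 0.
Proof.
move=> [w1 w2] /(congr1 (@complex.Re _)) /= h.
have {}h : \int[mu]_(z in D) (complex.Re (w z) ^+ 2 + complex.Im (w z) ^+ 2) = 0.
  by rewrite -[RHS]h; apply: eq_Rintegral => z _; case: (w z) => x y /=; ring.
rewrite (bdd_intD mu mD (bdd_measX 2 w1) (bdd_measX 2 w2)) in h.
have p1 : 0 <= \int[mu]_(z in D) complex.Re (w z) ^+ 2.
  by apply: Rintegral_ge0 => z _; exact: sqr_ge0.
have p2 : 0 <= \int[mu]_(z in D) complex.Im (w z) ^+ 2.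
  by apply: Rintegral_ge0 => z _; exact: sqr_ge0.
have e1 : \int[mu]_(z in D) complex.Re (w z) = 0 by apply: int_sqr_eq0 => //; lra.
have e2 : \int[mu]_(z in D) complex.Im (w z) = 0 by apply: int_sqr_eq0 => //; lra.
by rewrite /cint e1 e2.
Qed.

Lemma int_full (f : T -> R) : bdd_meas D f ->
  (\int[mu]_z (f z)%:E = 0)%E -> \int[mu]_(z in D) f z = 0.
Proof.
move=> hf h.
have mDC : measurable (~` D) by exact: measurableC.
have eD : [set: T] `\` ~` D = D by rewrite setTD setCK.
have hI : mu.-integrable [set: T] (EFin \o f).
  apply/(negligible_integrable mDC measurableT _ muD).
    by apply/measurable_EFinP; case: hf.
  by rewrite eD; exact: bdd_meas_integrable.
have := negligible_integral mDC measurableT hI muD.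
by rewrite eD /= h /Rintegral => <-.
Qed.

Lemma cint_OP n p k : monic_OP mu n p -> (k < n)%N ->
  cint (fun z => p.[toC z] * (toC z)^* ^+ k) = 0.
Proof.
move=> [_ _ hp] /hp[h1 h2].
have hb : cbdd_meas (fun z => p.[toC z] * ((toC z) ^+ k)^*).
  apply: cbddM; first exact: cbdd_horner.
  by apply: cbdd_conj; apply: cbddX; exact: cbdd_toC.
transitivity (cint (fun z => p.[toC z] * ((toC z) ^+ k)^*)).
  by apply: eq_cint => z _; rewrite rmorphXn.
by case: hb => hb1 hb2; rewrite /cint (int_full hb1 h1) (int_full hb2 h2).
Qed.

Section Szego.
Variable al : nat -> R.
Local Notation C x := (Complex x 0 : R[i]).

Fixpoint szego (n : nat) : {poly R[i]} * {poly R[i]} :=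
  if n is m.+1 then
    ('X * (szego m).1 - C (al m) *: (szego m).2,
     (szego m).2 - C (al m) *: ('X * (szego m).1))
  else (1, 1).

Local Notation Phi n := (szego n).1.
Local Notation Phis n := (szego n).2.

Lemma szego_monic n : [/\ Phi n \is monic, size (Phi n) = n.+1,
  (size (Phis n) <= n.+1)%N & (Phis n).[0] = 1].
Proof.
elim: n => [|n [IH1 IH2 IH3 IH4]] /=.
  by rewrite monic1 size_poly1 hornerC.
have sX : size ('X * Phi n) = n.+2.
  by rewrite mulrC size_mulX ?monic_neq0// IH2.
have s2 : (size (- (C (al n) *: Phis n)) < size ('X * Phi n)%R)%N.
  by rewrite size_polyN sX ltnS (leq_trans (size_scale_leq _ _)).
split.
- by rewrite monicE lead_coefDl// lead_coefM lead_coefX mul1r -monicE.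
- by rewrite size_polyDl.
- rewrite (leq_trans (size_polyD _ _))// geq_max (leq_trans IH3)//= size_polyN.
  by rewrite (leq_trans (size_scale_leq _ _))// sX.
- by rewrite hornerD hornerN hornerZ hornerM hornerX IH4; ring.
Qed.

Lemma szego_star n z : D z -> (Phis n).[toC z] = toC z ^+ n * ((Phi n).[toC z])^*.
Proof.
move=> Dz; elim: n => [|n IH] /=.
  by rewrite expr0 mul1r hornerC rmorph1.
have zz := toC_conj Dz.
rewrite !hornerE IH rmorphB !rmorphM rmorphXn /= conjCK.
have -> : (C (al n))^* = C (al n) by apply/eqP; rewrite eq_complex /= oppr0 !eqxx.
set Z := toC z in zz *; set P := (Phi n).[Z].
transitivity ((Z * Z^*) * Z ^+ n * P^* - C (al n) * (Z * ((Z * Z^*) ^+ n) * P)).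
  by rewrite zz expr1n; ring.
by rewrite exprS exprMn; ring.
Qed.

Hypothesis hver : forall n, verblunsky_is mu n (C (al n)).

Lemma szego_orth n k : (k < n)%N ->
  cint (fun z => (Phi n).[toC z] * (toC z)^* ^+ k) = 0.
Proof.
have bh (p : {poly R[i]}) j : cbdd_meas (fun z => p.[toC z] * (toC z)^* ^+ j).
  by apply: cbddM; [exact: cbdd_horner|exact: cbdd_conjX].
elim: n k => // n IH.
have shift j : cint (fun z => ('X * Phi n).[toC z] * (toC z)^* ^+ j.+1) =
    cint (fun z => (Phi n).[toC z] * (toC z)^* ^+ j).
  apply: eq_cint => z Dz; rewrite !hornerE exprS.
  by rewrite -[RHS]mul1r -(toC_conj Dz); ring.
have star k : (0 < k <= n)%N -> cint (fun z => (Phis n).[toC z] * (toC z)^* ^+ k) = 0.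
  move=> /andP[k0 kn].
  transitivity (cint (fun z => ((Phi n).[toC z] * (toC z)^* ^+ (n - k))^*)).
    apply: eq_cint => z Dz; rewrite szego_star// rmorphM rmorphXn /= conjCK.
    rewrite -{1}(subnK kn) exprD.
    have := toC_conj Dz; set Z := toC z => zz.
    transitivity ((Z * Z^*) ^+ k * (Z ^+ (n - k) * ((Phi n).[Z])^*)).
      by rewrite exprMn; ring.
    by rewrite zz expr1n; ring.
  by rewrite cint_conj// IH ?rmorph0// ltn_subrL k0 (leq_trans k0 kn).
have succ j : (j < n)%N -> cint (fun z => (Phi n.+1).[toC z] * (toC z)^* ^+ j.+1) = 0.
  move=> jn.
  transitivity (cint (fun z => ('X * Phi n).[toC z] * (toC z)^* ^+ j.+1) -
      C (al n) * cint (fun z => (Phis n).[toC z] * (toC z)^* ^+ j.+1)).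
    rewrite -cintZ// -cintB//; last exact: cbddZ.
    apply: eq_cint => z _; rewrite -[Phi n.+1]/('X * Phi n - C (al n) *: Phis n).
    by rewrite hornerD hornerN hornerZ; ring.
  by rewrite shift IH// star// mulr0 subr0.
move=> [_|k]; last by rewrite ltnS; exact: succ.
have [p [hp hp0]] := hver n.
have [pm ps _] := hp.
have [Pm Ps _ _] := szego_monic n.+1.
set Q := Phi n.+1 in Pm Ps succ *.
have Q0 : Q.[0] = - C (al n).
  have [_ _ _ s0] := szego_monic n.
  rewrite /Q -[Phi n.+1]/('X * Phi n - C (al n) *: Phis n).
  by rewrite hornerD hornerN hornerZ hornerM hornerX s0; ring.
have p0 : p.[0] = - C (al n).
  have := congr1 (fun x => (- x)^*) hp0; rewrite opprK conjCK => <-.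
  by apply/eqP; rewrite eq_complex /= !oppr0 !eqxx.
have /factor_theorem[E hE] : root (p - Q) 0 by rewrite /root hornerD hornerN p0 Q0 subrr.
rewrite subr0 in hE.
have sE : (size E <= n)%N.
  have [->|E0] := eqVneq E 0; first by rewrite size_poly0.
  rewrite -ltnS -(size_mulX E0) -hE.
  apply/leq_sizeP => j; rewrite leq_eqVlt => /orP[/eqP <-|jn].
    have := monicP pm; have := monicP Pm; rewrite /lead_coef ps Ps /= => e1 e2.
    by rewrite coefB; apply/eqP; rewrite subr_eq0 e1; apply/eqP.
  by rewrite coefB !nth_default ?subr0// ?ps ?Ps.
have orthE k : (k < n)%N -> cint (fun z => E.[toC z] * (toC z)^* ^+ k) = 0.
  move=> kn.
  transitivity (cint (fun z => p.[toC z] * (toC z)^* ^+ k.+1) -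
                cint (fun z => Q.[toC z] * (toC z)^* ^+ k.+1)).
    rewrite -cintB//; apply: eq_cint => z Dz.
    rewrite -mulrBl -hornerN -hornerD hE !hornerE exprS.
    by rewrite -[LHS]mul1r -(toC_conj Dz); ring.
  by rewrite (cint_OP hp) ?ltnS// succ// subrr.
have EE : cint (fun z => E.[toC z] * (E.[toC z])^*) = 0.
  transitivity (cint (fun z => \sum_(i < size E) (E`_i)^* * (E.[toC z] * (toC z)^* ^+ i))).
    apply: eq_cint => z _; rewrite {2}horner_coef rmorph_sum mulr_sumr.
    by apply: eq_bigr => i _; rewrite rmorphM rmorphXn; ring.
  have sumE (r : seq 'I_(size E)) :
      cbdd_meas (fun z => \sum_(i <- r) (E`_i)^* * (E.[toC z] * (toC z)^* ^+ i)) /\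
      cint (fun z => \sum_(i <- r) (E`_i)^* * (E.[toC z] * (toC z)^* ^+ i)) = 0.
    elim: r => [|i r [IH1 IH2]].
      under eq_fun do rewrite big_nil; split; first exact: cbdd_cst.
      transitivity (cint (fun z => 0 * 0)); first by apply: eq_cint => *; rewrite mul0r.
      by rewrite cintZ ?mul0r//; exact: cbdd_cst.
    have bi : cbdd_meas (fun z => (E`_i)^* * (E.[toC z] * (toC z)^* ^+ i)) by exact: cbddZ.
    under eq_fun do rewrite big_cons; split; first exact: cbddD.
    by rewrite cintD// IH2 addr0 cintZ// orthE ?mulr0// (leq_trans (ltn_ord i)).
  by have [] := sumE (index_enum _).
have h0 : cint (fun z => toC z * E.[toC z]) = 0.
  apply: cint_sqr_eq0; first by apply: cbddM; [exact: cbdd_toC|exact: cbdd_horner].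
  rewrite -[RHS]EE; apply: eq_cint => z Dz; rewrite rmorphM.
  by rewrite -[RHS]mul1r -(toC_conj Dz); ring.
transitivity (cint (fun z => p.[toC z] * (toC z)^* ^+ 0) - cint (fun z => toC z * E.[toC z])).
  rewrite -cintB//; last by apply: cbddM; [exact: cbdd_toC|exact: cbdd_horner].
  apply: eq_cint => z _; rewrite !expr0 !mulr1.
  have -> : toC z * E.[toC z] = (p - Q).[toC z] by rewrite hE !hornerE mulrC.
  by rewrite hornerD hornerN; ring.
by rewrite (cint_OP hp)// h0 subrr.
Qed.

End Szego.
End ComplexIntegrals.

Section InitialOrthogonality.
Variables (R : realType) (mu : probability (R * R)%type R) (D : set (R * R)%type).
Hypothesis mD : measurable D.
Hypothesis muD : mu (~` D) = 0%E.
Hypothesis Dcirc : forall z, D z -> z.1 ^+ 2 + z.2 ^+ 2 = 1.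
Variables (a : nat -> R -> R) (t : R).
Local Notation T := (R * R)%type.
Local Notation C x := (Complex x 0 : R[i]).
Local Notation Phi n := (szego (fun k => a k t) n).1.
Local Notation Phis n := (szego (fun k => a k t) n).2.
Local Notation u n := (volterra a n t).

Definition para (n : nat) (z : T) : R[i] :=
  if n is m.+1 then toC z * (Phi m).[toC z] - (-1) ^+ m * (Phis m).[toC z] else 1.

Lemma para_rec n z :
  para n.+2 z = (toC z - 1) * para n.+1 z + C (2 * u n) * toC z * para n z.
Proof.
have hC (x : R) : C x = (x%:C)%C by [].
pose e : R[i] := (-1) ^+ n.
have hu : C (2 * u n) = (1 - e * C (a n t)) * (1 - e * C (prev_coef a n t)).
  rewrite /volterra /e !hC (_ : 2 * _ =
    (1 - (-1) ^+ n * a n t) * (1 - (-1) ^+ n * prev_coef a n t)); last by field.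
  by rewrite !(rmorphM, rmorphB, rmorphXn, rmorphN, rmorph1).
rewrite hu /para.
have PhiS m : (Phi m.+1).[toC z] = toC z * (Phi m).[toC z] - C (a m t) * (Phis m).[toC z].
  by rewrite -[Phi m.+1]/('X * Phi m - C (a m t) *: Phis m) hornerD hornerN hornerZ hornerM hornerX.
have PhisS m : (Phis m.+1).[toC z] = (Phis m).[toC z] - C (a m t) * (toC z * (Phi m).[toC z]).
  by rewrite -[Phis m.+1]/(Phis m - C (a m t) *: ('X * Phi m)) hornerD hornerN hornerZ hornerM hornerX.
case: n @e hu => [|n] e hu.
  rewrite PhiS PhisS /e -[Phi 0]/(1 : {poly R[i]}) -[Phis 0]/(1 : {poly R[i]}) !hornerC.
  have -> : C (prev_coef a 0 t) = -1 by apply/eqP; rewrite eq_complex /= oppr0 !eqxx.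
  by ring.
rewrite -[prev_coef _ _ _]/(a n t) !(PhiS, PhisS) /e !exprS.
set A := C (a n.+1 t); set B := C (a n t); set Z := toC z; set P := (Phi n).[Z]; set Q := (Phis n).[Z].
set s := (-1) ^+ n.
have [->|->] : s = 1 \/ s = -1 by rewrite /s -signr_odd; case: odd; [right|left].
  by ring.
by ring.
Qed.

Lemma renorm_para n z : D z ->
  (-2) ^+ n * C (renorm (fun k => u k) n (1 - z.1)) =
    (toC z)^* ^+ n * para n z * (toC z - 1) ^+ n /\
  (-2) ^+ n.+1 * C (renorm (fun k => u k) n.+1 (1 - z.1)) =
    (toC z)^* ^+ n.+1 * para n.+1 z * (toC z - 1) ^+ n.+1.
Proof.
move=> Dz.
have hC (x : R) : C x = (x%:C)%C by [].
have zz := toC_conj Dcirc Dz.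
have hq : -2 * C (1 - z.1) = (toC z)^* * (toC z - 1) ^+ 2.
  transitivity ((toC z)^* - 2 * ((toC z) * (toC z)^*) + toC z * ((toC z) * (toC z)^*)); last by ring.
  rewrite zz; apply/eqP; rewrite eq_complex /=; apply/andP; split; apply/eqP; ring.
have p1 : para 1 z = toC z - 1.
  by rewrite /para /= !hornerC expr0 mulr1 mul1r.
elim: n => [|n [IH1 IH2]].
  split; first by rewrite !expr0 !mul1r.
  by rewrite p1 !expr1 -[renorm _ _ _]/(1 - z.1) hq; ring.
split; first exact: IH2.
rewrite renormSS para_rec.
have -> : C ((1 - z.1) * (renorm (fun k => u k) n.+1 (1 - z.1) -
      u n * renorm (fun k => u k) n (1 - z.1))) =
    C (1 - z.1) * (C (renorm (fun k => u k) n.+1 (1 - z.1)) -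
      C (u n) * C (renorm (fun k => u k) n (1 - z.1))).
  by rewrite !hC !(rmorphM, rmorphB).
have -> : C (2 * u n) = 2 * C (u n) by rewrite !hC rmorphM /= rmorphMn /= rmorph1.
transitivity ((-2 * C (1 - z.1)) * ((-2) ^+ n.+1 * C (renorm (fun k => u k) n.+1 (1 - z.1))
   + 2 * C (u n) * ((-2) ^+ n * C (renorm (fun k => u k) n (1 - z.1))))).
  by rewrite !exprS; ring.
rewrite IH1 IH2 hq.
transitivity ((toC z)^* * (toC z - 1) ^+ 2 *
  ((toC z)^* ^+ n.+1 * para n.+1 z * (toC z - 1) ^+ n.+1 +
   2 * C (u n) * ((toC z * (toC z)^*) * (toC z)^* ^+ n * para n z * (toC z - 1) ^+ n))).
  by rewrite zz mul1r.
by rewrite !exprS; ring.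
Qed.

Hypothesis hver : forall n, verblunsky_is mu n (C (a n t)).

Lemma renorm_step_int0 n : \int[mu]_(z in D)
  (renorm (fun k => u k) n.+1 (1 - z.1) - u n * renorm (fun k => u k) n (1 - z.1)) = 0.
Proof.
have hC (x : R) : C x = (x%:C)%C by [].
have cb := cbdd_toC Dcirc.
have bp m : cbdd_meas D (para m).
  case: m => [|m]; first exact: cbdd_cst.
  by apply: cbddB; [apply: cbddM => //|apply: cbddZ]; exact: cbdd_horner.
have bx j k : cbdd_meas D (fun z => para n.+2 z * (toC z)^* ^+ k * (toC z - 1) ^+ j).
  apply: cbddM; first by apply: cbddM => //; exact: cbdd_conjX.
  by apply: cbddX; apply: cbddB => //; exact: cbdd_cst.
have orth k : (0 < k <= n.+1)%N -> cint mu D (fun z => para n.+2 z * (toC z)^* ^+ k) = 0.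
  case: k => // k /andP[_]; rewrite ltnS => kn.
  have b1 i : cbdd_meas D (fun z => (Phi n.+1).[toC z] * (toC z)^* ^+ i).
    by apply: cbddM; [exact: cbdd_horner|exact: cbdd_conjX].
  pose f z := ((Phi n.+1).[toC z] * (toC z)^* ^+ (n - k))^*.
  have bf : cbdd_meas D f by exact: cbdd_conj.
  transitivity (cint mu D (fun z => (Phi n.+1).[toC z] * (toC z)^* ^+ k) - (-1) ^+ n.+1 * cint mu D f).
    rewrite -cintZ// -cintB//; last exact: cbddZ.
    apply: eq_cint => z Dz.
    rewrite /para (szego_star Dcirc)// /f rmorphM rmorphXn /= conjCK.
    have := toC_conj Dcirc Dz; set Z := toC z; set P := _.[_] => zz.
    transitivity ((Z * Z^*) * (P * Z^* ^+ k) -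
      (-1) ^+ n.+1 * ((Z * Z^*) ^+ k.+1 * (P^* * Z ^+ (n - k)))).
      by rewrite exprMn -[in X in Z ^+ X](subnK kn) !exprS !exprD; ring.
    by rewrite zz expr1n !mul1r.
  rewrite (szego_orth mD muD Dcirc hver)// /f cint_conj// (szego_orth mD muD Dcirc hver) ?ltnS ?leq_subr//.
  by rewrite rmorph0 mulr0 subrr.
have orthj j : forall k, (j < k <= n.+1)%N ->
    cint mu D (fun z => para n.+2 z * (toC z)^* ^+ k * (toC z - 1) ^+ j) = 0.
  elim: j => [|j IH] k hk.
    by rewrite -[RHS](orth k hk); apply: eq_cint => z _; rewrite expr0 mulr1.
  case: k hk => // k /andP[jk kn].
  transitivity (cint mu D (fun z => para n.+2 z * (toC z)^* ^+ k * (toC z - 1) ^+ j) -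
                cint mu D (fun z => para n.+2 z * (toC z)^* ^+ k.+1 * (toC z - 1) ^+ j)).
    rewrite -cintB//; apply: eq_cint => z Dz.
    transitivity (para n.+2 z * ((toC z * (toC z)^*) * (toC z)^* ^+ k) * (toC z - 1) ^+ j -
      para n.+2 z * (toC z)^* ^+ k.+1 * (toC z - 1) ^+ j); last by rewrite (toC_conj Dcirc Dz) mul1r.
    by rewrite !exprS; ring.
  have k1 : (j < k <= n.+1)%N by rewrite -ltnS jk ltnW.
  have k2 : (j < k.+1 <= n.+1)%N by rewrite (ltn_trans (ltnSn j) jk) kn.
  by rewrite (IH k k1) (IH k.+1 k2) subrr.
set f := fun z : T => renorm _ _ _ - _.
have ef z : D z -> (-2) ^+ n.+1 * C (f z) = para n.+2 z * (toC z)^* ^+ n.+1 * (toC z - 1) ^+ n.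
  move=> Dz; have [h1 h2] := renorm_para n Dz.
  transitivity ((-2) ^+ n.+1 * C (renorm (fun k => u k) n.+1 (1 - z.1))
     + 2 * C (u n) * ((-2) ^+ n * C (renorm (fun k => u k) n (1 - z.1)))).
    by rewrite /f !hC rmorphB rmorphM !exprS /=; ring.
  rewrite h1 h2 para_rec.
  have -> : C (2 * u n) = 2 * C (u n) by rewrite !hC rmorphM /= rmorphMn /= rmorph1.
  transitivity ((toC z)^* ^+ n.+1 * para n.+1 z * (toC z - 1) ^+ n.+1 +
    2 * C (u n) * ((toC z * (toC z)^*) * (toC z)^* ^+ n * para n z * (toC z - 1) ^+ n)).
    by rewrite (toC_conj Dcirc Dz) mul1r.
  by rewrite !exprS; ring.
have n20 : ((-2) ^+ n.+1 : R[i]) != 0 by rewrite expf_neq0// oppr_eq0 pnatr_eq0.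
have eC : cint mu D (fun z => C (f z)) = 0.
  transitivity (cint mu D (fun z => ((-2) ^+ n.+1)^-1 *
     (para n.+2 z * (toC z)^* ^+ n.+1 * (toC z - 1) ^+ n))).
    by apply: eq_cint => z Dz; rewrite -ef// mulKf.
  by rewrite cintZ// orthj ?mulr0// !leqnn.
by rewrite -(cint_re mu (w := fun z => C (f z)))// eC.
Qed.

End InitialOrthogonality.

Section LaplaceFunctional.
Variables (R : realType) (mu : probability (R * R)%type R) (D : set (R * R)%type).
Hypothesis mD : measurable D.
Hypothesis Dcirc : forall z, D z -> z.1 ^+ 2 + z.2 ^+ 2 = 1.
Local Notation T := (R * R)%type.

Lemma circle_coord_itv (z : T) : D z -> 0 <= 1 - z.1 <= 2.
Proof. by move=> Dz; have [] := circle_le1 Dcirc Dz; rewrite ler_norml => /andP[]; lra. Qed.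

Lemma bdd_meas_coord : bdd_meas D (fun z : T => 1 - z.1).
Proof.
apply: bdd_measB; first exact: bdd_meas_cst.
by split; [exact: measurable_fst|exists 1 => z /(circle_le1 Dcirc)[]].
Qed.

Lemma expR_coord_le (s M : R) (z : T) : `|s| <= M -> D z ->
  expR (- 2 * s * (1 - z.1)) <= expR (4 * M).
Proof.
move=> sM /circle_coord_itv q02; rewrite ler_expR.
by move: sM; rewrite ler_norml => /andP[]; nra.
Qed.

Lemma bdd_meas_exp (t : R) : bdd_meas D (fun z : T => expR (- 2 * t * (1 - z.1))).
Proof.
have [m1 _] := bdd_meas_coord.
split; last first.
  by exists (expR (4 * `|t|)) => z Dz; rewrite ger0_norm ?expR_ge0// expR_coord_le.
apply: (@measurableT_comp _ _ _ _ _ _ expR setT (fun z : T => - 2 * t * (1 - z.1))) => //.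
exact: measurable_funM.
Qed.

Definition lap (t : R) (f : R -> R) : R :=
  \int[mu]_(z in D) (f (1 - z.1) * expR (- 2 * t * (1 - z.1))).

Definition lapp (t : R) (p : {poly R}) : R := lap t (fun q => p.[q]).

Lemma bdd_meas_lapp t (p : {poly R}) :
  bdd_meas D (fun z : T => p.[1 - z.1] * expR (- 2 * t * (1 - z.1))).
Proof.
apply: bdd_measM; last exact: bdd_meas_exp.
by apply: bdd_meas_horner; exact: bdd_meas_coord.
Qed.

Lemma lappD t p1 p2 : lapp t (p1 + p2) = lapp t p1 + lapp t p2.
Proof.
rewrite /lapp /lap -(bdd_intD mu mD (bdd_meas_lapp t p1) (bdd_meas_lapp t p2)).
by apply: eq_Rintegral => z _; rewrite hornerD mulrDl.
Qed.

Lemma lappZ t c p : lapp t (c *: p) = c * lapp t p.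
Proof.
rewrite /lapp /lap -(bdd_intZ mu mD c (bdd_meas_lapp t p)).
by apply: eq_Rintegral => z _; rewrite hornerZ mulrA.
Qed.

Lemma lapp0 t : lapp t 0 = 0.
Proof. by rewrite -(scale0r 0) lappZ mul0r. Qed.

Lemma lappB t p1 p2 : lapp t (p1 - p2) = lapp t p1 - lapp t p2.
Proof. by rewrite -scaleN1r lappD lappZ mulN1r. Qed.

Lemma lapp_ge0 t p : (forall q, 0 <= q <= 2 -> 0 <= p.[q]) -> 0 <= lapp t p.
Proof.
move=> hp; apply: Rintegral_ge0 => z Dz; rewrite mulr_ge0 ?expR_ge0//.
exact/hp/circle_coord_itv.
Qed.

Lemma lapp_sum t n (F : nat -> {poly R}) :
  lapp t (\sum_(i < n) F i) = \sum_(i < n) lapp t (F i).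
Proof.
elim: n => [|n IHn]; first by rewrite !big_ord0 lapp0.
by rewrite !big_ord_recr /= lappD IHn.
Qed.

Lemma lapp_orth t (p : {poly R}) k :
  (forall j, (j < k)%N -> lapp t (p * 'X^j) = 0) ->
  forall r : {poly R}, (size r <= k)%N -> lapp t (p * r) = 0.
Proof.
move=> h r sr; rewrite -[r]coefK poly_def mulr_sumr.
rewrite (lapp_sum t (size r) (fun i => p * (r`_i *: 'X^i))) big1// => i _.
by rewrite -scalerAr lappZ h ?mulr0// (leq_trans (ltn_ord i)).
Qed.

Section Renorm.
Variable u : nat -> R -> R.
Hypothesis u02 : forall n t, 0 <= u n t <= 2.
Hypothesis flow0 : forall t : R, is_derive t 1 (u 0) (- 2 * u 0 t * u 1 t).
Hypothesis flowS : forall n (t : R),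
  is_derive t 1 (u n.+1) (- 2 * u n.+1 t * (u n.+2 t - u n t)).
Local Notation rn n t := (renorm (fun k => u k t) n).
Local Notation step n t q := (rn n.+1 t q - u n t * rn n t q).

Lemma bdd_meas_renorm n t : bdd_meas D (fun z : T => rn n t (1 - z.1)).
Proof.
have hq := bdd_meas_coord.
suff : bdd_meas D (fun z : T => rn n t (1 - z.1)) /\
    bdd_meas D (fun z : T => rn n.+1 t (1 - z.1)) by case.
elim: n => [|n [IH1 IH2]].
  by split; [exact: bdd_meas_cst|exact: hq].
split; first exact: IH2.
by apply: bdd_measM => //; apply: bdd_measB => //; exact: bdd_measZ.
Qed.

Lemma bdd_meas_step n t : bdd_meas D (fun z : T =>
  step n t (1 - z.1) * expR (- 2 * t * (1 - z.1))).
Proof.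
apply: bdd_measM; last exact: bdd_meas_exp.
by apply: bdd_measB; [|apply: bdd_measZ]; exact: bdd_meas_renorm.
Qed.

Lemma is_derive_lap_step n (t : R) :
  is_derive t 1 (fun s => lap s (fun q => step n s q))
    (- 2 * u n.+1 t * lap t (fun q => step n t q)
      - 2 * lap t (fun q => step n.+1 t q)).
Proof.
pose f s (z : T) := step n s (1 - z.1) * expR (- 2 * s * (1 - z.1)).
pose df s (z : T) : R := - 2 * u n.+1 s * (step n s (1 - z.1) * expR (- 2 * s * (1 - z.1)))
   - 2 * (step n.+1 s (1 - z.1) * expR (- 2 * s * (1 - z.1))).
have der (s : R) z : D z -> is_derive s 1 (f^~ z) (df s z).
  move=> Dz; set q : R := 1 - z.1.
  have h1 : is_derive s 1 (fun s => - 2 * s * q) (- 2 * q).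
    have E : (fun s : R => - 2 * s * q) = (fun s => (- 2 * q) * s).
      by apply/funext => x; ring.
    rewrite E; apply: is_derive_eq (is_derive_scale (- 2 * q) (is_derive_id s 1)) _.
    by rewrite mulr1.
  have h2 := @is_derive1_comp R expR (fun s => - 2 * s * q) s _ _ (is_derive_expR _) h1.
  apply: is_derive_eq (is_derive_mul (is_derive_renorm_step flow0 flowS n s q) h2) _.
  by rewrite /df -/q renormSS /comp; ring.
have bnd : exists C : R, forall s z, t - 1 < s < t + 1 -> D z -> `|df s z| <= C.
  exists (72 * 4 ^+ n * expR (4 * (`|t| + 1))) => s z hs Dz.
  have sM : `|s| <= `|t| + 1.
    have h1 := ler_norm t; have h2 := ler_norm (- t); rewrite normrN in h2.
    by rewrite ler_norml; lra.
  have q02 := circle_coord_itv Dz; set q := 1 - z.1 in q02 *.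
  have he := expR_coord_le sM Dz; have e0 := expR_ge0 (- 2 * s * q).
  rewrite -/q in he; set e := expR (- 2 * s * q) in he e0 *; set M := expR _ in he *.
  have s1 := renorm_step_le n (fun k => u02 k s) q02.
  have s2 := renorm_step_le n.+1 (fun k => u02 k s) q02.
  have /andP[u0 u2] := u02 n.+1 s.
  rewrite /df -/q -/e; apply: le_trans (ler_normB _ _) _.
  rewrite !normrM normrN (ger0_norm e0) (ger0_norm u0) (@ger0_norm _ 2)//.
  rewrite exprS in s2.
  have h1 : `|step n s q| * e <= 6 * 4 ^+ n * M by exact: ler_pM.
  have h2 : `|step n.+1 s q| * e <= 6 * (4 * 4 ^+ n) * M by exact: ler_pM.
  have h3 : u n.+1 s * (`|step n s q| * e) <= 2 * (6 * 4 ^+ n * M).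
    by apply: ler_pM => //; rewrite mulr_ge0.
  by rewrite -mulrA; lra.
apply: is_derive_eq (@is_derive_bdd_int _ _ _ mu _ mD f df t (bdd_meas_step n) der bnd) _.
rewrite /lap -(bdd_intZ mu mD _ (bdd_meas_step n t)).
rewrite -(bdd_intZ mu mD _ (bdd_meas_step n.+1 t)).
by rewrite -(bdd_intB mu mD (bdd_measZ _ (bdd_meas_step n t)) (bdd_measZ _ (bdd_meas_step n.+1 t))).
Qed.

Hypothesis init : forall n, lap 0 (fun q => step n 0 q) = 0.

Lemma lap_step0 n t : 0 <= t -> lap t (fun q => step n t q) = 0.
Proof.
move=> t0.
apply: (@lattice_ode_unique R u (fun n s => lap s (fun q => step n s q)) 6) => //.
  exact: is_derive_lap_step.
move=> {t0}{}n {}t t0; apply: bdd_int_norm_le => //.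
- exact: bdd_meas_step.
- move=> z Dz; have q02 := circle_coord_itv Dz.
  rewrite normrM -[X in _ <= X]mulr1; apply: ler_pM => //.
    exact: renorm_step_le.
  rewrite ger0_norm ?expR_ge0// -[X in _ <= X]expR0 ler_expR.
  have : 0 <= t * (1 - z.1) by rewrite mulr_ge0//; case/andP: q02.
  by move: (1 - z.1) => q tq; rewrite -mulrA; lra.
Qed.

End Renorm.

Section OrthogonalPolynomials.
Variable v : nat -> R.
Hypothesis v02 : forall n, 0 <= v n <= 2.

(* [(opPQ k).1] and [(opPQ k).2] will be the monic orthogonal polynomials of
   degree [k] in [q = 1 - x] for the weights [1] and [q]. *)
Fixpoint opPQ (k : nat) : {poly R} * {poly R} :=
  if k is m.+1 then
    let P := 'X * (opPQ m).2 - v m.*2 *: (opPQ m).1 in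
    (P, P - v m.*2.+1 *: (opPQ m).2)
  else (1, 1).
Local Notation P k := (opPQ k).1.
Local Notation Q k := (opPQ k).2.

Lemma opPS k : P k.+1 = 'X * Q k - v k.*2 *: P k. Proof. by []. Qed.
Lemma opQS k : Q k.+1 = P k.+1 - v k.*2.+1 *: Q k. Proof. by []. Qed.

Lemma opPQ_monic k : [/\ P k \is monic, size (P k) = k.+1,
  Q k \is monic & size (Q k) = k.+1].
Proof.
elim: k => [|k [IH1 IH2 IH3 IH4]]; first by rewrite /= monic1 size_poly1.
have addl (A B : {poly R}) c m : A \is monic -> size A = m.+2 -> size B = m.+1 ->
    (A - c *: B \is monic) /\ size (A - c *: B) = m.+2.
  move=> mA sA sB.
  have lt : (size (- (c *: B)) < size A)%N.
    by rewrite size_polyN sA ltnS (leq_trans (size_scale_leq _ _))// sB.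
  by split; [rewrite monicE lead_coefDl// -monicE|rewrite size_polyDl].
have mX : 'X * Q k \is monic by rewrite monicMl ?monicX.
have sX : size ('X * Q k) = k.+2 by rewrite mulrC size_mulX ?monic_neq0// IH4.
have [m1 s1] := addl _ _ (v k.*2) _ mX sX IH2.
by have [m2 s2] := addl _ _ (v k.*2.+1) _ m1 s1 IH4.
Qed.

Lemma opPQ_le k q : 0 <= q <= 2 -> `|(P k).[q]| <= 8 ^+ k /\ `|(Q k).[q]| <= 8 ^+ k.
Proof.
move=> /andP[q0 q2]; elim: k => [|k [IH1 IH2]].
  by rewrite /= hornerC normr1 expr0.
have hP : `|(P k.+1).[q]| <= 4 * 8 ^+ k.
  rewrite opPS hornerD hornerN hornerZ hornerM hornerX.
  apply: le_trans (ler_normB _ _) _; rewrite !normrM (ger0_norm q0).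
  have /andP[u0 u2] := v02 k.*2; rewrite (ger0_norm u0).
  have : q * `|(Q k).[q]| <= 2 * 8 ^+ k by exact: ler_pM.
  have : v k.*2 * `|(P k).[q]| <= 2 * 8 ^+ k by exact: ler_pM.
  lra.
have e0 : 0 <= 8 ^+ k :> R by rewrite exprn_ge0.
rewrite exprS; split; first by lra.
rewrite opQS hornerD hornerN hornerZ.
apply: le_trans (ler_normB _ _) _; rewrite normrM.
have /andP[u0 u2] := v02 k.*2.+1; rewrite (ger0_norm u0).
have : v k.*2.+1 * `|(Q k).[q]| <= 2 * 8 ^+ k by exact: ler_pM.
lra.
Qed.

Lemma renorm_opPQ k q : renorm v k.*2 q = q ^+ k * (P k).[q] /\
  renorm v k.*2.+1 q = q ^+ k.+1 * (Q k).[q].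
Proof.
elim: k => [|k [IH1 IH2]]; first by rewrite /= !hornerC expr0 expr1 !mulr1.
have h : renorm v k.+1.*2 q = q ^+ k.+1 * (P k.+1).[q].
  rewrite doubleS renormSS IH1 IH2 opPS hornerD hornerN hornerZ hornerM hornerX.
  by rewrite !exprS; ring.
split=> //; rewrite doubleS renormSS -[k.*2.+2]doubleS h IH2 opQS.
by rewrite hornerD hornerN hornerZ !exprS; ring.
Qed.

Variable t : R.
Hypothesis step0 : forall n, lap t (fun q => renorm v n.+1 q - v n * renorm v n q) = 0.

Lemma opPQ_step k : lapp t (P k.+1 * 'X^k) = 0 /\ lapp t ('X * Q k.+1 * 'X^k) = 0.
Proof.
split.
- rewrite -[RHS](step0 k.*2) /lapp; congr lap; apply/funext => q.
  have [-> ->] := renorm_opPQ k q.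
  rewrite opPS !(hornerD, hornerN, hornerZ, hornerM, hornerX, hornerXn) exprS.
  by ring.
- rewrite -[RHS](step0 k.*2.+1) /lapp; congr lap; apply/funext => q.
  have [_ ->] := renorm_opPQ k q; have [-> _] := renorm_opPQ k.+1 q.
  rewrite opQS !(hornerD, hornerN, hornerZ, hornerM, hornerX, hornerXn) !exprS.
  by ring.
Qed.

Lemma opPQ_orth k j : (j < k)%N ->
  lapp t (P k * 'X^j) = 0 /\ lapp t ('X * Q k * 'X^j) = 0.
Proof.
elim: k j => // k IH.
have hP j : (j < k.+1)%N -> lapp t (P k.+1 * 'X^j) = 0.
  rewrite ltnS leq_eqVlt => /orP[/eqP ->|jk]; first by have [] := opPQ_step k.
  have [h1 h2] := IH j jk.
  by rewrite opPS mulrBl -scalerAl lappB lappZ h1 h2 mulr0 subrr.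
move=> j jk; split; first exact: hP.
move: jk; rewrite ltnS leq_eqVlt => /orP[/eqP ->|jk]; first by have [] := opPQ_step k.
have [h1 h2] := IH j jk.
rewrite opQS mulrBr mulrBl -scalerAr -scalerAl lappB lappZ h2 mulr0 subr0.
by rewrite mulrAC -exprS mulrC hP.
Qed.

Lemma lapp_renorm n : lap t (renorm v n.+1) = v n * lap t (renorm v n).
Proof.
have e m : exists p : {poly R}, renorm v m = (fun q => p.[q]).
  move: (m./2) (odd_double_half m) => j; case: odd => /= <-.
  - exists ('X ^+ j.+1 * Q j); apply/funext => q.
    by rewrite add1n; have [_ ->] := renorm_opPQ j q; rewrite hornerM hornerXn.
  - exists ('X ^+ j * P j); apply/funext => q.
    by rewrite add0n; have [-> _] := renorm_opPQ j q; rewrite hornerM hornerXn.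
have [p1 e1] := e n.+1; have [p0 e0] := e n.
have := step0 n; rewrite e1 e0 -/(lapp t p1) -/(lapp t p0) -lappZ => h.
apply/eqP; rewrite -subr_eq0 -lappB -[X in _ == X]h; apply/eqP.
by congr lap; apply/funext => q; rewrite !hornerE.
Qed.

Definition normP k := lapp t (P k * P k).
Definition normQ k := lapp t ('X * Q k * Q k).

Lemma monic_subXn_size (p : {poly R}) k : p \is monic -> size p = k.+1 ->
  (size (p - 'X^k)%R <= k)%N.
Proof.
move=> mp sp; apply/leq_sizeP => j; rewrite leq_eqVlt => /orP[/eqP <-|kj].
  have := monicP mp; rewrite /lead_coef sp /= => h.
  by rewrite coefB coefXn eqxx h subrr.
by rewrite coefB coefXn (gtn_eqF kj) nth_default ?subr0// sp.
Qed.

Lemma normPE k : normP k = lap t (renorm v k.*2).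
Proof.
have [m s _ _] := opPQ_monic k.
rewrite /normP -{2}(subrK 'X^k (P k)) mulrDr lappD (@lapp_orth t (P k) k).
- rewrite add0r; congr lap; apply/funext => q.
  by have [-> _] := renorm_opPQ k q; rewrite !hornerE mulrC.
- by move=> j /opPQ_orth[].
- exact: monic_subXn_size.
Qed.

Lemma normQE k : normQ k = lap t (renorm v k.*2.+1).
Proof.
have [_ _ m s] := opPQ_monic k.
rewrite /normQ -{2}(subrK 'X^k (Q k)) mulrDr lappD (@lapp_orth t ('X * Q k) k).
- rewrite add0r; congr lap; apply/funext => q.
  by have [_ ->] := renorm_opPQ k q; rewrite !hornerE exprS; ring.
- by move=> j /opPQ_orth[].
- exact: monic_subXn_size.
Qed.

Lemma normPS k : normP k.+1 = v k.*2.+1 * v k.*2 * normP k.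
Proof. by rewrite !normPE doubleS !lapp_renorm mulrA. Qed.

Lemma normQS k : normQ k.+1 = v k.*2.+2 * v k.*2.+1 * normQ k.
Proof. by rewrite !normQE doubleS !lapp_renorm mulrA. Qed.

Definition vprev n := if n is m.+1 then v m else 0.

Lemma opP_three k (y : R) : ('X - y%:P) * P k =
  P k.+1 + (v k.*2 + vprev k.*2 - y) *: P k +
  (if k is m.+1 then (v m.*2.+1 * v m.*2) *: P m else 0).
Proof.
case: k => [|k].
  by rewrite opPS /= -!mul_polyC !rmorphB !rmorphD /= !rmorph0; ring.
rewrite (opPS k.+1) (opQS k) -[vprev _]/(v k.*2.+1) -[v k.+1.*2]/(v k.*2.+2).
have -> : P k.+1 = 'X * Q k - v k.*2 *: P k by [].
by rewrite -!mul_polyC !(rmorphB, rmorphD, rmorphM) /=; ring.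
Qed.

Lemma opQ_three k (y : R) : ('X - y%:P) * Q k =
  Q k.+1 + (v k.*2.+1 + v k.*2 - y) *: Q k +
  (if k is m.+1 then (v m.*2.+2 * v m.*2.+1) *: Q m else 0).
Proof.
case: k => [|k].
  by rewrite opQS opPS /= -!mul_polyC !rmorphB !rmorphD /=; ring.
rewrite (opQS k.+1) (opPS k.+1) -[v k.+1.*2]/(v k.*2.+2).
have -> : P k.+1 = Q k.+1 + v k.*2.+1 *: Q k by rewrite opQS subrK.
by rewrite -!mul_polyC !(rmorphB, rmorphD, rmorphM) /=; ring.
Qed.

Lemma orth_sum_sqr (w A B E : {poly R}) (s c : R) :
  lapp t (w * A * B) = 0 -> lapp t (w * A * E) = 0 -> lapp t (w * B * E) = 0 ->
  0 <= lapp t (w * E * E) ->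
  lapp t (w * A * A) + s ^+ 2 * lapp t (w * B * B) <=
  lapp t (w * (A + s *: B + c *: E) * (A + s *: B + c *: E)).
Proof.
move=> h1 h2 h3 h4.
have -> : w * (A + s *: B + c *: E) * (A + s *: B + c *: E) =
   w * A * A + (s ^+ 2) *: (w * B * B) + (c ^+ 2) *: (w * E * E) +
   (2 * s) *: (w * A * B) + (2 * c) *: (w * A * E) + (2 * s * c) *: (w * B * E).
  by rewrite -!mul_polyC !(polyCM, polyC_exp, polyC_natr); ring.
rewrite !lappD !lappZ h1 h2 h3 !mulr0 !addr0 lerDl.
by rewrite mulr_ge0 ?sqr_ge0.
Qed.

Lemma varianceP k (y : R) :
  normP k.+1 + (v k.*2 + vprev k.*2 - y) ^+ 2 * normP k <=
  lapp t ((('X - y%:P) * P k) * (('X - y%:P) * P k)).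
Proof.
have or i j : (j < i)%N -> lapp t (1 * P i * P j) = 0.
  move=> ji; rewrite mul1r; apply: (@lapp_orth t (P i) i).
    by move=> m /opPQ_orth[].
  by have [_ -> _ _] := opPQ_monic j.
have -> : ('X - y%:P) * P k * (('X - y%:P) * P k) = 1 * (('X - y%:P) * P k) * (('X - y%:P) * P k).
  by rewrite mul1r.
rewrite opP_three /normP -[P k.+1 * P k.+1]mul1r -[P k * P k]mul1r !(mulrA 1).
have pos p : 0 <= lapp t (1 * p * p).
  by apply: lapp_ge0 => q _; rewrite mul1r hornerM -expr2 sqr_ge0.
case: k => [|k].
  have := @orth_sum_sqr 1 (P 1) (P 0) 0 (v 0.*2 + vprev 0.*2 - y) 0 (or 1%N 0%N isT).
  by rewrite scale0r !mulr0 !lapp0; exact.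
by apply: orth_sum_sqr => //; exact: or.
Qed.

Lemma varianceQ k (y : R) :
  normQ k.+1 + (v k.*2.+1 + v k.*2 - y) ^+ 2 * normQ k <=
  lapp t ('X * (('X - y%:P) * Q k) * (('X - y%:P) * Q k)).
Proof.
have or i j : (j < i)%N -> lapp t ('X * Q i * Q j) = 0.
  move=> ji; apply: (@lapp_orth t ('X * Q i) i).
    by move=> m /opPQ_orth[].
  by have [_ _ _ ->] := opPQ_monic j.
rewrite /normQ opQ_three.
have pos p : 0 <= lapp t ('X * p * p).
  apply: lapp_ge0 => q /andP[q0 _]; rewrite !hornerM hornerX -mulrA -expr2.
  by rewrite mulr_ge0// sqr_ge0.
case: k => [|k].
  have := @orth_sum_sqr 'X (Q 1) (Q 0) 0 (v 0.*2.+1 + v 0.*2 - y) 0 (or 1%N 0%N isT).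
  by rewrite scale0r !mulr0 !lapp0; exact.
by apply: orth_sum_sqr => //; exact: or.
Qed.

End OrthogonalPolynomials.
End LaplaceFunctional.

Section Concentration.
Variables (R : realType) (mu : probability (R * R)%type R) (D : set (R * R)%type).
Hypothesis mD : measurable D.
Hypothesis muD : mu (~` D) = 0%E.
Hypothesis Dcirc : forall z, D z -> z.1 ^+ 2 + z.2 ^+ 2 = 1.
Local Notation T := (R * R)%type.

Lemma finite_common_small (A : nat -> R -> Prop) k :
  (forall i r r', 0 < r' -> r' <= r -> A i r -> A i r') ->
  (forall i, (i < k)%N -> exists2 r, 0 < r & A i r) ->
  exists2 r, 0 < r & forall i, (i < k)%N -> A i r.
Proof.
move=> mono; elim: k => [|k IH] h; first by exists 1.
have [r r0 hr] := IH (fun i ik => h i (leqW ik)).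
have [s s0 hs] := h k (ltnSn k).
exists (Num.min r s); first by rewrite lt_min r0.
have m0 : 0 < Num.min r s by rewrite lt_min r0.
move=> i; rewrite ltnS leq_eqVlt => /orP[/eqP ->|ik].
- by apply: mono hs => //; rewrite ge_min lexx orbT.
- by apply: mono (hr i ik) => //; rewrite ge_min lexx.
Qed.

Lemma finite_common_large (A : nat -> R -> Prop) k :
  (forall i r r', r <= r' -> A i r -> A i r') ->
  (forall i, (i < k)%N -> exists r, A i r) ->
  exists r, forall i, (i < k)%N -> A i r.
Proof.
move=> mono; elim: k => [|k IH] h; first by exists 1.
have [r hr] := IH (fun i ik => h i (leqW ik)).
have [s hs] := h k (ltnSn k).
exists (Num.max r s) => i; rewrite ltnS leq_eqVlt => /orP[/eqP ->|ik].
- by apply: mono hs => //; rewrite le_max lexx orbT.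
- by apply: mono (hr i ik) => //; rewrite le_max lexx.
Qed.

Lemma monic_separated k (p : {poly R}) (x : nat -> R) (d : R) :
  p \is monic -> size p = k.+1 -> 0 < d ->
  (forall i j, (i < j <= k)%N -> d <= `|x i - x j|) ->
  exists2 i, (i <= k)%N & (d / 2) ^+ k <= `|p.[x i]|.
Proof.
move=> + + d0; elim: k p x => [|k IH] p x mp sp hx.
  exists 0%N => //; rewrite expr0.
  have := size1_polyC (eq_leq sp); have := monicP mp.
  by rewrite /lead_coef sp /= => -> ->; rewrite hornerC normr1.
apply: contrapT => hn.
have lt i : (i <= k.+1)%N -> `|p.[x i]| < (d / 2) ^+ k.+1.
  by move=> ik; rewrite ltNge; apply/negP => h; apply: hn; exists i.
have /factor_theorem[q hq] : root (p - p.[x 0%N]%:P) (x 0%N).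
  by rewrite /root hornerD hornerN hornerC subrr.
have sc : (size (- p.[x 0%N]%:P : {poly R}) < size p)%N.
  by rewrite size_polyN sp (leq_ltn_trans (size_polyC_leq1 _)).
have mX : 'X - (x 0%N)%:P \is monic by rewrite monicXsubC.
have mq : q \is monic.
  have := lead_coefDl sc; rewrite hq lead_coef_Mmonic// (monicP mp).
  by rewrite monicE => ->.
have sq : size q = k.+1.
  have := size_polyDl sc; rewrite hq size_Mmonic ?monic_neq0// size_XsubC sp addn2.
  by move=> [].
have [|i ik] := IH q (fun i => x i.+1) mq sq.
  by move=> i j /andP[ij jk]; apply: hx; rewrite ltnS ij.
rewrite leNgt => /negP; apply.
have h0 := lt 0%N isT; have hi := lt i.+1 ik.
have hd : d <= `|x i.+1 - x 0%N| by rewrite distrC; apply: hx.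
have e : `|q.[x i.+1]| * `|x i.+1 - x 0%N| = `|p.[x i.+1] - p.[x 0%N]|.
  have := congr1 (fun r : {poly R} => r.[x i.+1]) hq.
  by rewrite /= hornerD hornerN hornerC hornerM hornerXsubC => ->; rewrite normrM.
have h2 : `|q.[x i.+1]| * d < 2 * (d / 2) ^+ k.+1.
  apply: (@le_lt_trans _ _ (`|q.[x i.+1]| * `|x i.+1 - x 0%N|)); first exact: ler_wpM2l.
  by rewrite e; apply: le_lt_trans (ler_normB _ _) _; lra.
rewrite exprS (_ : 2 * _ = (d / 2) ^+ k * d) in h2; last by field.
by rewrite ltr_pM2r in h2.
Qed.

Lemma mu_setI_full (A : set T) : measurable A -> (0 < mu A)%E -> (0 < mu (A `&` D))%E.
Proof.
move=> mA; apply: contraTT; rewrite -!leNgt => h.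
have mDC : measurable (~` D) by exact: measurableC.
have nA : mu.-negligible A.
  have sub : A `<=` (A `&` D) `|` ~` D.
    by move=> z Az; have [Dz|nDz] := pselect (D z); [left|right].
  apply: negligibleS sub _; apply: negligibleU; apply/negligibleP => //; first exact: measurableI.
  by apply/eqP; rewrite eq_le h measure_ge0.
by move/negligibleP: nA => -> //.
Qed.

Lemma fine_mu_setI_gt0 (A : set T) : measurable A -> (0 < mu A)%E ->
  0 < fine (mu (A `&` D)).
Proof.
move=> mA A0; have mAD : measurable (A `&` D) by exact: measurableI.
rewrite -lte_fin fineK; first exact: mu_setI_full.
exact: fin_num_measure.
Qed.

Definition strip (x r : R) : set T := [set z | `|z.1 - x| < r].

Lemma measurable_strip x r : measurable (strip x r).
Proof.
have -> : strip x r = ball x r `*` setT.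
  apply/seteqP; split => z; rewrite /strip /ball /= distrC.
    by move=> h; split.
  by move=> [].
by apply: measurableX => //; exact: measurable_ball.
Qed.

Lemma strip_mass (z : T) r : supp mu z -> 0 < r -> 0 < fine (mu (strip z.1 r `&` D)).
Proof.
move=> hz r0; apply: fine_mu_setI_gt0; first exact: measurable_strip.
apply: lt_le_trans (hz r r0) _; apply: le_measure; rewrite ?inE.
- exact: measurable_prod_ball.
- exact: measurable_strip.
- by move=> w [/= h _]; rewrite /strip /= distrC.
Qed.

Definition atom (q : R) : set T := [set z | 1 - z.1 = q].

Lemma measurable_atom q : measurable (atom q).
Proof.
have -> : atom q = [set (1 - q)] `*` setT.
  apply/seteqP; split => z; rewrite /atom /=; last by move=> [-> _]; ring.
  by move=> <-; split => //; ring.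
by apply: measurableX => //; exact: measurable_set1.
Qed.

Lemma atom_mass (z : T) r : supp mu z -> 0 < r ->
  (forall w, D w -> `|w.1 - z.1| < r -> w.1 = z.1) ->
  0 < fine (mu (atom (1 - z.1) `&` D)).
Proof.
move=> hz r0 h; apply: lt_le_trans (strip_mass hz r0) _.
apply: fine_le; [exact: fin_num_measure (measurableI _ _ (measurable_strip _ _) mD)|
  exact: fin_num_measure (measurableI _ _ (measurable_atom _) mD)|].
apply: le_measure; rewrite ?inE.
- exact: measurableI (measurable_strip _ _) mD.
- exact: measurableI (measurable_atom _) mD.
- by move=> w [hw Dw]; split => //; rewrite /atom /= (h w).
Qed.

Lemma lapp_lower (k : nat) (Z : nat -> T) (w : {poly R}) (y : R) :
  (forall q, 0 <= q <= 2 -> 0 <= w.[q]) ->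
  (forall i, (i <= k)%N -> [/\ supp mu (Z i), 1 - (Z i).1 < y & 0 < w.[1 - (Z i).1]]) ->
  (forall i j, (i < j <= k)%N -> (Z i).1 != (Z j).1) ->
  exists2 c, 0 < c & forall t p, 0 <= t -> p \is monic -> size p = k.+1 ->
    c * expR (- 2 * t * y) <= lapp mu D t (w * p * p).
Proof.
move=> w0 hZ hne.
pose A1 (i : nat) (r : R) := [/\ 1 - (Z i).1 + r <= y,
  (forall q, `|q - (1 - (Z i).1)| < r -> r <= w.[q]) &
  forall j, (j <= k)%N -> j != i -> 4 * r <= `|(Z i).1 - (Z j).1|].
have [r r0 hr] : exists2 r, 0 < r & forall i, (i < k.+1)%N -> A1 i r.
  apply: finite_common_small.
    move=> i s s' s0 ss [h1 h2 h3]; split; first by lra.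
      by move=> q hq; apply: (le_trans ss); apply: h2; exact: lt_le_trans hq ss.
    by move=> j jk ji; apply: le_trans (h3 j jk ji); lra.
  move=> i; rewrite ltnS => ik; have [_ h1 h2] := hZ i ik.
  have [r1 r10 hr1] : exists2 r, 0 < r & forall q, `|q - (1 - (Z i).1)| < r -> r <= w.[q].
    have cw : {for 1 - (Z i).1, continuous (horner w)} by exact: continuous_horner.
    have w20 : 0 < w.[1 - (Z i).1] / 2 by rewrite divr_gt0.
    have /cvgrPdist_lt/(_ _ w20)/nbhs_ballP[e e0 he] := cw.
    exists (Num.min e (w.[1 - (Z i).1] / 2)); first by rewrite lt_min e0.
    move=> q; rewrite lt_min => /andP[q1 _].
    have := he q; rewrite /ball /= distrC => /(_ q1); rewrite ltr_norml => /andP[h3 h4].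
    by rewrite ge_min; apply/orP; right; lra.
  have [r2 r20 hr2] : exists2 r, 0 < r & forall j, (j < k.+1)%N -> j != i -> 4 * r <= `|(Z i).1 - (Z j).1|.
    apply: (@finite_common_small (fun j r => j != i -> 4 * r <= `|(Z i).1 - (Z j).1|)).
      by move=> j s s' s0 ss h ji; apply: le_trans (h ji); lra.
    move=> j; rewrite ltnS => jk; have [->|ji] := eqVneq j i; first by exists 1.
    exists (`|(Z i).1 - (Z j).1| / 4); last by move=> _; lra.
    rewrite divr_gt0// normr_gt0 subr_eq0.
    move: ji; rewrite neq_ltn => /orP[ji|ij]; last by apply: hne; rewrite ij.
    by rewrite eq_sym; apply: hne; rewrite ji.
  exists (Num.min (y - (1 - (Z i).1)) (Num.min r1 r2)).
    by rewrite !lt_min r10 r20 subr_gt0 h1.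
  set m := Num.min _ _.
  have m1 : m <= y - (1 - (Z i).1) by rewrite ge_min lexx.
  have m2 : m <= r1 by rewrite !ge_min lexx orbT.
  have m3 : m <= r2 by rewrite !ge_min lexx !orbT.
  split; first by lra.
    by move=> q hq; apply: (le_trans m2); apply: hr1; exact: lt_le_trans hq m2.
  by move=> j jk ji; apply: le_trans (hr2 j jk ji); lra.
have [m m0 hm] : exists2 m, 0 < m &
    forall i, (i < k.+1)%N -> m <= fine (mu (strip (Z i).1 r `&` D)).
  apply: finite_common_small; first by move=> i s s' _ ss; apply: le_trans.
  move=> i ik; exists (fine (mu (strip (Z i).1 r `&` D))) => //.
  by apply: strip_mass => //; have [] := hZ i ik.
pose eta := (2 * r / 2) ^+ k.
have eta0 : 0 < eta by rewrite exprn_gt0//; lra.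
exists (r * eta ^+ 2 * m); first by rewrite !mulr_gt0// exprn_gt0.
move=> t p t0 mp sp.
have [i ik hi] : exists2 i, (i <= k)%N &
    forall z, D z -> strip (Z i).1 r z -> eta <= `|p.[1 - z.1]|.
  apply: contrapT => hn.
  have /choice[x hx] : forall i, exists z, (i <= k)%N ->
      [/\ D z, strip (Z i).1 r z & `|p.[1 - z.1]| < eta].
    move=> i; have [ik|ik] := leqP i k; last by exists (0, 0) => h.
    apply: contrapT => hz; apply: hn; exists i => // z Dz sz.
    rewrite leNgt; apply/negP => lt; apply: hz; exists z => _; split => //.
  have r2 : 0 < 2 * r by lra.
  have [|i ik] := @monic_separated k p (fun i => 1 - (x i).1) (2 * r) mp sp r2.
    move=> i j /andP[ij jk].
    have ik : (i <= k)%N by rewrite (leq_trans (ltnW ij)).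
    have [_ h1 _] := hx i ik; have [_ h2 _] := hx j jk.
    have [_ _ /(_ j jk)] := hr i ik; rewrite gtn_eqF// => /(_ isT).
    rewrite /strip /= in h1 h2.
    have := ler_distD (x i).1 (Z i).1 (Z j).1; have := ler_distD (x j).1 (x i).1 (Z j).1.
    rewrite (distrC (Z i).1 (x i).1).
    have -> : `|1 - (x i).1 - (1 - (x j).1)| = `|(x i).1 - (x j).1|.
      by rewrite distrC; congr `|_|; ring.
    by lra.
  by have [_ _ lt] := hx i ik; rewrite leNgt => /negP; apply.
have [Ai1 Ai2 _] := hr i ik.
pose c := r * eta ^+ 2 * expR (- 2 * t * y).
have c0 : 0 <= c by rewrite !mulr_ge0 ?expR_ge0 ?sqr_ge0// ltW.
apply: (@le_trans _ _ (c * fine (mu (strip (Z i).1 r `&` D)))).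
  rewrite (_ : _ * _ * _ * _ = c * m); last by rewrite /c; ring.
  exact: ler_wpM2l (hm i ik).
rewrite -(bdd_int_indic mu mD); last exact: measurable_strip.
apply: (bdd_int_le mu mD).
- by apply: bdd_measZ; apply: bdd_meas_indic; exact: measurable_strip.
- exact: bdd_meas_lapp.
- move=> z Dz; have q02 := circle_coord_itv Dcirc Dz.
  rewrite !hornerM.
  have e0 := expR_ge0 (- 2 * t * (1 - z.1)).
  have rhs : w.[1 - z.1] * p.[1 - z.1] * p.[1 - z.1] * expR (- 2 * t * (1 - z.1)) =
      w.[1 - z.1] * `|p.[1 - z.1]| ^+ 2 * expR (- 2 * t * (1 - z.1)).
    by rewrite real_normK ?num_real//; ring.
  rewrite rhs.
  have [sz|nsz] := pselect (strip (Z i).1 r z); last first.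
    rewrite indicE memNset// mulr0 !mulr_ge0//; exact: w0.
  rewrite indicE mem_set// mulr1 /c.
  have hq : `|1 - z.1 - (1 - (Z i).1)| < r.
    by rewrite (_ : _ - _ = (Z i).1 - z.1) ?[`|(Z i).1 - _|]distrC//; ring.
  apply: ler_pM.
  - by rewrite mulr_ge0 ?sqr_ge0// ltW.
  - exact: expR_ge0.
  - apply: ler_pM; [exact: ltW|exact: sqr_ge0|exact: Ai2|].
    by rewrite ler_sqr ?nnegrE ?normr_ge0//; [exact: hi|exact: ltW].
  - rewrite ler_expR; move: hq; rewrite ltr_norml => /andP[_ hq].
    have : 1 - z.1 <= y by lra.
    by move: (1 - z.1) => q qy; nra.
Qed.

Lemma poly_bounded (p : {poly R}) : exists2 B, 0 <= B & forall q, 0 <= q <= 2 -> `|p.[q]| <= B.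
Proof.
elim/poly_ind: p => [|p c [B B0 hB]]; first by exists 0 => // q _; rewrite horner0 normr0.
exists (B * 2 + `|c|); first by rewrite addr_ge0// mulr_ge0.
move=> q q02; rewrite hornerMXaddC; apply: le_trans (ler_normD _ _) _.
rewrite lerD2r normrM ler_pM ?hB//; move: q02 => /andP[q0 q2].
by rewrite ger0_norm.
Qed.

Section Main.
Variables (k : nat) (w : {poly R}) (p : R -> {poly R}) (C : R).
Hypothesis w02 : forall q, 0 <= q <= 2 -> 0 <= w.[q] <= 2.
Hypothesis p_le : forall t q, 0 <= t -> 0 <= q <= 2 -> `|(p t).[q]| <= C.
Hypothesis p_monic : forall t, 0 <= t -> p t \is monic /\ size (p t) = k.+1.
Hypothesis p_orth : forall t (r : {poly R}), 0 <= t -> (size r <= k)%N ->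
  lapp mu D t (w * p t * r) = 0.
Variables (r : nat) (Q : nat -> R) (y : R).
Hypothesis rk : (r <= k)%N.
Hypothesis y02 : 0 <= y <= 2.
Hypothesis Q_neq : forall i j, (i < r)%N -> (j < r)%N -> i != j -> Q i != Q j.
Hypothesis Q_lt : forall i, (i < r)%N -> Q i < y.
Hypothesis Q_w : forall i, (i < r)%N -> 0 < w.[Q i].
Hypothesis Q_mass : forall i, (i < r)%N -> 0 < fine (mu (atom (Q i) `&` D)).
Hypothesis cover : forall z, D z ->
  [\/ w.[1 - z.1] = 0, (exists2 i, (i < r)%N & 1 - z.1 = Q i) | y <= 1 - z.1].
Hypothesis lower : forall e, 0 < e -> exists2 c, 0 < c &
  forall t p, 0 <= t -> p \is monic -> size p = k.+1 ->
    c * expR (- 2 * t * (y + e)) <= lapp mu D t (w * p * p).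

(* The polynomial of degree [r - 1] vanishing at the other atoms isolates the
   value of [p t] at the atom [Q i]. *)
Lemma atom_value_small i : (i < r)%N -> exists2 K, 0 <= K &
  forall t, 0 <= t -> `|(p t).[Q i]| * expR (- 2 * t * Q i) <= K * expR (- 2 * t * y).
Proof.
move=> ir.
pose pi : {poly R} := \prod_(j < r | j != i :> nat) ('X - (Q j)%:P).
have spi : (size pi <= r)%N.
  have full : \prod_(j < r) ('X - (Q j)%:P) = pi * ('X - (Q i)%:P).
    by rewrite mulrC (bigD1 (Ordinal ir)).
  have pi0 : pi != 0 by apply/prodf_neq0 => j _; rewrite polyXsubC_eq0.
  have := size_prod_XsubC (index_enum 'I_r) (fun j => Q j).
  rewrite full size_Mmonic ?monicXsubC// size_XsubC addn2 /= => -[->].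
  by rewrite /index_enum -enumT size_enum_ord.
have pi_i : pi.[Q i] != 0.
  rewrite /pi horner_prod; apply/prodf_neq0 => j ji.
  by rewrite hornerXsubC subr_eq0 Q_neq// eq_sym.
have pi_j j : (j < r)%N -> j != i -> pi.[Q j] = 0.
  move=> jr ji; rewrite /pi horner_prod (bigD1 (Ordinal jr))//=.
  by rewrite hornerXsubC subrr mul0r.
have [B B0 hB] := poly_bounded pi.
have C0 : 0 <= C by apply: le_trans (p_le (lexx 0) y02); rewrite normr_ge0.
set m := fine (mu (atom (Q i) `&` D)).
have m0 : 0 < m by exact: Q_mass.
have N0 : 0 < w.[Q i] * `|pi.[Q i]| * m by rewrite !mulr_gt0 ?normr_gt0// Q_w.
exists (2 * C * B / (w.[Q i] * `|pi.[Q i]| * m)).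
  by apply: divr_ge0; [rewrite !mulr_ge0|exact: ltW].
move=> t t0.
pose A := w.[Q i] * (p t).[Q i] * pi.[Q i] * expR (- 2 * t * Q i).
have mA : bdd_meas D (fun z => A * \1_(atom (Q i)) z).
  by apply: bdd_measZ; apply: bdd_meas_indic; exact: measurable_atom.
have mG := bdd_meas_lapp Dcirc t (w * p t * pi).
have spk : (size pi <= k)%N by exact: leq_trans rk.
have : `|A * m| <= 2 * C * B * expR (- 2 * t * y).
  rewrite -(bdd_int_indic mu mD A (measurable_atom _)) -normrN.
  rewrite -[X in `|X|]add0r -(p_orth t0 spk) /lapp /lap -(bdd_intB mu mD mG mA).
  apply: bdd_int_norm_le.
  - exact: mD.
  - exact: bdd_measB.
  - by rewrite !mulr_ge0// expR_ge0.
  move=> z Dz; have q02 := circle_coord_itv Dcirc Dz.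
  have rhs0 : 0 <= 2 * C * B * expR (- 2 * t * y) by rewrite !mulr_ge0// expR_ge0.
  have [qi|qi] := eqVneq (1 - z.1) (Q i).
    rewrite indicE mem_set//= mulr1 qi !hornerM /A.
    by rewrite subrr normr0.
  rewrite indicE memNset ?mulr0 ?subr0; last by move/eqP; rewrite (negbTE qi).
  case: (cover Dz) => [w0|[j jr qj]|yq].
  - by rewrite !hornerM w0 !mul0r normr0.
  - have ji : j != i by apply: contra_neq qi => <-.
    by rewrite qj !hornerM pi_j// mulr0 mul0r normr0.
  - rewrite !hornerM !normrM (ger0_norm (expR_ge0 _)).
    have hw : `|w.[1 - z.1]| <= 2 by have /andP[wa wb] := w02 q02; rewrite ger0_norm.
    have h1 := ler_pM (normr_ge0 _) (normr_ge0 _) hw (p_le t0 q02).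
    have h2 := ler_pM (mulr_ge0 (normr_ge0 _) (normr_ge0 _)) (normr_ge0 _) h1 (hB _ q02).
    apply: ler_pM h2 _; [by rewrite !mulr_ge0|exact: expR_ge0|].
    rewrite ler_expR; move: (1 - z.1) yq => q yq; nra.
rewrite /A !normrM (ger0_norm (expR_ge0 _)) (gtr0_norm (Q_w ir)) (gtr0_norm m0) => h.
rewrite [X in _ <= X]mulrAC ler_pdivlMr//.
by apply: le_trans h; rewrite le_eqVlt; apply/orP; left; apply/eqP; ring.
Qed.

Lemma concentration e : 0 < e -> exists2 t0, 0 <= t0 & forall t, t0 <= t ->
  lapp mu D t (w * (('X - y%:P) * p t) * (('X - y%:P) * p t)) <= e * lapp mu D t (w * p t * p t).
Proof.
move=> e0.
have C0 : 0 <= C by apply: le_trans (p_le (lexx 0) y02); rewrite normr_ge0.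
have [g g0 hg] : exists2 g, 0 < g & forall i, (i < r)%N -> g <= y - Q i.
  apply: finite_common_small; first by move=> i s s' _ ss; apply: le_trans.
  by move=> i ir; exists (y - Q i) => //; rewrite subr_gt0 Q_lt.
pose d := Num.min g (Num.min 1 (e / 2)).
have d0 : 0 < d by rewrite !lt_min g0 ltr01 divr_gt0.
have dg : d <= g by rewrite ge_min lexx.
have de : d ^+ 2 <= e / 2.
  have d1 : d <= 1 by rewrite !ge_min lexx orbT.
  have d2 : d <= e / 2 by rewrite !ge_min lexx !orbT.
  by rewrite expr2; apply: le_trans d2; rewrite ger_pMl.
have [K hK] : exists K, forall i, (i < r)%N -> forall t, 0 <= t ->
    (p t).[Q i] ^+ 2 * expR (- 2 * t * Q i) <= K * expR (- 2 * t * (y + d)).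
  apply: finite_common_large.
    move=> i s s' ss h t t0; apply: le_trans (h t t0) _.
    by rewrite ler_wpM2r// expR_ge0.
  move=> i ir; have [K K0 hK] := atom_value_small ir.
  exists (K ^+ 2) => t t0; have h := hK t t0.
  set E := expR (- 2 * t * Q i) in h *; set Y := expR (- 2 * t * y) in h.
  have E0 : 0 < E by exact: expR_gt0.
  have Y0 : 0 < Y by exact: expR_gt0.
  have h2 : (p t).[Q i] ^+ 2 * E <= K ^+ 2 * (Y ^+ 2 / E).
    have : (`|(p t).[Q i]| * E) ^+ 2 <= (K * Y) ^+ 2.
      by rewrite ler_sqr ?nnegrE ?mulr_ge0// ltW.
    rewrite !exprMn real_normK ?num_real// => h3.
    rewrite mulrA ler_pdivlMr// -mulrA -expr2//.
  apply: le_trans h2 _; rewrite ler_wpM2l ?sqr_ge0//.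
  rewrite /Y /E expr2 -expRD -expRN -expRD ler_expR.
  have := hg i ir; nra.
have [c c0 hc] := lower (divr_gt0 d0 (ltr0n R 2)).
pose K' := 8 * (C ^+ 2 + `|K|) + 1.
have K0 : 0 < K' by rewrite ltr_wpDl// mulr_ge0// addr_ge0// sqr_ge0.
have T0 : 0 <= 2 * K' / (c * e * d) by rewrite ltW// divr_gt0 ?mulr_gt0.
exists (2 * K' / (c * e * d)) => // t tt0.
have t0 : 0 <= t := le_trans T0 tt0.
have [pm ps] := p_monic t0.
set H := lapp mu D t (w * p t * p t).
have hH : c * expR (- 2 * t * (y + d / 2)) <= H by exact: hc.
have step1 : lapp mu D t (w * (('X - y%:P) * p t) * (('X - y%:P) * p t)) <=
    e / 2 * H + K' * expR (- 2 * t * (y + d)).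
  have b1 := bdd_measZ (e / 2) (bdd_meas_lapp Dcirc t (w * p t * p t)).
  have b2 := bdd_meas_cst D (K' * expR (- 2 * t * (y + d))).
  apply: (@le_trans _ _ (\int[mu]_(z in D) (e / 2 * ((w * p t * p t).[1 - z.1] * expR (- 2 * t * (1 - z.1)))
     + K' * expR (- 2 * t * (y + d))))); last first.
    rewrite (bdd_intD mu mD b1 b2) (bdd_intZ mu mD _ (bdd_meas_lapp Dcirc t _)).
    rewrite lerD2l Rintegral_cst// ler_piMr//.
      by rewrite mulr_ge0 ?expR_ge0// ltW.
    rewrite -lee_fin fineK; last exact: fin_num_measure.
    exact: probability_le1.
  apply: (bdd_int_le mu mD) (bdd_meas_lapp Dcirc t _) (bdd_measD b1 b2) _ => z Dz.
  have q02 := circle_coord_itv Dcirc Dz; set q := 1 - z.1 in q02 *.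
  rewrite !hornerM hornerXsubC; set P := (p t).[q]; set E := expR (- 2 * t * q).
  have E0 : 0 <= E by exact: expR_ge0.
  have /andP[w0 w2] := w02 q02.
  set Yd := expR (- 2 * t * (y + d)); have Yd0 : 0 <= Yd by exact: expR_ge0.
  have -> : w.[q] * ((q - y) * P) * ((q - y) * P) * E = w.[q] * (q - y) ^+ 2 * (P ^+ 2 * E) by ring.
  have -> : w.[q] * P * P * E = w.[q] * (P ^+ 2 * E) by ring.
  have PE0 : 0 <= P ^+ 2 * E by rewrite mulr_ge0// sqr_ge0.
  have K'0 : 0 <= K' * Yd by rewrite mulr_ge0// ltW.
  have e20 : 0 <= e / 2 by rewrite ltW// divr_gt0.
  have eH0 : 0 <= e / 2 * (w.[q] * (P ^+ 2 * E)).
    by apply: mulr_ge0 => //; exact: mulr_ge0.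
  have qy4 : (q - y) ^+ 2 <= 4.
    by move: y02 q02 => /andP[? ?] /andP[? ?]; nra.
  have w8 : w.[q] * (q - y) ^+ 2 <= 8.
    by rewrite (_ : 8 = 2 * 4); [apply: ler_pM => //; exact: sqr_ge0|ring].
  have wq0 : 0 <= w.[q] * (q - y) ^+ 2 by rewrite mulr_ge0// sqr_ge0.
  have big B : P ^+ 2 * E <= B * Yd -> B <= C ^+ 2 + `|K| ->
      w.[q] * (q - y) ^+ 2 * (P ^+ 2 * E) <= K' * Yd.
    move=> h1 h2; apply: (@le_trans _ _ (8 * (B * Yd))); first exact: ler_pM.
    by rewrite mulrA ler_wpM2r// /K'; lra.
  have := cover Dz; rewrite -/q => -[wq|[i ir qi]|yq].
  - by rewrite wq !(mul0r, mulr0) add0r.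
  - apply: (@le_trans _ _ (K' * Yd)); last by rewrite lerDr.
    apply: (big K); last by have := ler_norm K; have := sqr_ge0 C; lra.
    by rewrite /P /E qi; exact: hK.
  - have [lt|ge] := ltP q (y + d).
      apply: (@le_trans _ _ (e / 2 * (w.[q] * (P ^+ 2 * E)))); last by rewrite lerDl.
      rewrite -mulrA mulrCA ler_wpM2r//; first by rewrite mulr_ge0.
      have qy : 0 <= q - y by rewrite subr_ge0.
      by apply: le_trans de; rewrite ler_sqr ?nnegrE// ?ltW// ltrBlDl.
    apply: (@le_trans _ _ (K' * Yd)); last by rewrite lerDr.
    apply: (big (C ^+ 2)); last by rewrite lerDl.
    apply: ler_pM => //; first exact: sqr_ge0.
      rewrite -[P ^+ 2]real_normK ?num_real// ler_sqr ?nnegrE//.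
      exact: p_le.
    by rewrite ler_expR; nra.
apply: le_trans step1 _.
have step2 : K' * expR (- 2 * t * (y + d)) <= e / 2 * H.
  apply: le_trans (ler_wpM2l _ hH); last by rewrite ltW// divr_gt0.
  have -> : - 2 * t * (y + d) = - 2 * t * (y + d / 2) - t * d by field.
  rewrite expRD expRN; set Y := expR (- 2 * t * _); have Y0 : 0 < Y by exact: expR_gt0.
  have td : 1 + t * d <= expR (t * d) by exact: expR_ge1Dx.
  rewrite (_ : e / 2 * (c * Y) = (e / 2 * c) * Y); last by ring.
  rewrite (mulrC Y) mulrA ler_pM2r// ler_pdivrMr ?expR_gt0//.
  apply: le_trans (ler_wpM2l _ td); last by rewrite mulr_ge0// ?divr_ge0// ltW.
  have : 2 * K' <= t * (c * e * d).
    by rewrite -ler_pdivrMr// !mulr_gt0.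
  have : 0 < e * c by rewrite mulr_gt0.
  by lra.
by lra.
Qed.

End Main.
End Concentration.

Section CircleGeometry.
Variables (R : realType) (mu : probability (R * R)%type R).
Hypothesis mu_circ : on_circle mu.
Local Notation T := (R * R)%type.

Lemma circ_param (z : T) : z.1 ^+ 2 + z.2 ^+ 2 = 1 ->
  exists2 eta : R, `|eta| <= pi & z = circ eta.
Proof.
case: z => x y /= h.
have x1 : -1 <= x <= 1 by apply/andP; split; nra.
have xI : x \in `[-1, 1] by rewrite in_itv.
have s2 : Num.sqrt (1 - x ^+ 2) = `|y|.
  by rewrite -sqrtr_sqr; congr Num.sqrt; lra.
have p0 := acos_ge0 x1; have pp := acos_lepi x1.
have [y0|y0] := leP 0 y.
- exists (acos x); first by rewrite ger0_norm.
  by rewrite /circ acosK// sin_acos// s2 ger0_norm.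
- exists (- acos x); first by rewrite normrN ger0_norm.
  by rewrite /circ cosN sinN acosK// sin_acos// s2 ltr0_norm// opprK.
Qed.

Lemma cos_norm (x : R) : cos `|x| = cos x.
Proof. by have [x0|x0] := leP 0 x; [rewrite ger0_norm|rewrite ltr0_norm// cosN]. Qed.

Lemma cos_le_pi (x y : R) : 0 <= x -> x <= y -> y <= pi -> cos y <= cos x.
Proof.
move=> x0 xy yp; rewrite leNgt; apply/negP => h.
move: h; rewrite ltr_cos ?in_itv /= ?x0 ?(le_trans xy)// ?(le_trans x0)//.
by rewrite ltNge xy.
Qed.

Lemma cos_lt_pi (x y : R) : 0 <= x -> x < y -> y <= pi -> cos y < cos x.
Proof.
move=> x0 xy yp; rewrite ltr_cos ?in_itv /= ?x0 ?(le_trans (ltW xy))//.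
by rewrite (le_trans x0 (ltW xy)).
Qed.

Lemma ess_near (z : T) e : ess_supp mu z -> 0 < e ->
  exists w : T, supp mu w /\ 0 < `|w.1 - z.1| < e.
Proof.
move=> [hz hess] e0.
pose e' := if z.2 == 0 then e else Num.min e `|z.2|.
have e'0 : 0 < e'.
  by rewrite /e'; case: eqVneq => // z2; rewrite lt_min e0 normr_gt0.
have e'e : e' <= e by rewrite /e'; case: ifP => // _; rewrite ge_min lexx.
have [w [hw wz [b1 b2]]] := hess e' e'0.
exists w; split=> //; apply/andP; split; last first.
  by rewrite distrC; exact: lt_le_trans b1 e'e.
rewrite normr_gt0 subr_eq0; apply/eqP => e1; apply: wz.
have cz := supp_circle mu_circ hz; have cw := supp_circle mu_circ hw.
have : (w.2 - z.2) * (w.2 + z.2) = 0.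
  by rewrite -subr_sqr; rewrite e1 in cw; lra.
move/eqP; rewrite mulf_eq0 subr_eq0 => /orP[/eqP e2|].
  by rewrite [w]surjective_pairing [z]surjective_pairing e1 e2.
rewrite addr_eq0 => /eqP e2.
have [z20|z20] := eqVneq z.2 0.
  by rewrite [w]surjective_pairing [z]surjective_pairing e1 e2 z20 oppr0.
move: b2; rewrite /ball /= /e' (negbTE z20) e2 opprK lt_min => /andP[_].
rewrite -mulr2n normrMn => h; exfalso; move: h.
by have := normr_ge0 z.2; rewrite mulr2n; lra.
Qed.

Lemma ess_spots (z : T) e : ess_supp mu z -> 0 < e -> exists Z : nat -> T,
  (forall i, supp mu (Z i) /\ `|(Z i).1 - z.1| < e) /\
  (forall i j, (i < j)%N -> (Z i).1 != (Z j).1).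
Proof.
move=> hz e0.
have /choice[g hg] : forall d : R, exists w : T, 0 < d -> supp mu w /\ 0 < `|w.1 - z.1| < d.
  move=> d; have [d0|d0] := ltP 0 d; last by exists z.
  by have [w hw] := ess_near hz d0; exists w.
pose Z := fix Z n := if n is m.+1 then g `|(Z m).1 - z.1| else g e.
have ZP n : supp mu (Z n) /\ 0 < `|(Z n).1 - z.1|.
  elim: n => [|n [_ IH]]; first by have [? /andP[]] := hg e e0.
  by have [? /andP[]] := hg _ IH.
have Zdec n : `|(Z n.+1).1 - z.1| < `|(Z n).1 - z.1|.
  by have [_ h] := ZP n; have [_ /andP[]] := hg _ h.
have Zlt i j : (i < j)%N -> `|(Z j).1 - z.1| < `|(Z i).1 - z.1|.
  elim: j => // j IH; rewrite ltnS leq_eqVlt => /orP[/eqP ->|/IH]; first exact: Zdec.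
  exact: lt_trans (Zdec j).
exists Z; split=> [i|i j ij].
- have [h _] := ZP i; split=> //.
  have h0 : `|(Z 0%N).1 - z.1| < e by have [_ /andP[]] := hg e e0.
  by case: i {h} => // i; exact: lt_trans (Zlt 0%N i.+1 isT) h0.
- by apply/eqP => e1; have := Zlt i j ij; rewrite e1 ltxx.
Qed.

Section Theta.
Variable Th : R.
Hypothesis hTh : is_Theta mu Th.

Lemma Theta_facts : 0 <= Th <= pi /\
  exists th : R, ess_supp mu (circ th) /\ cos th = cos Th.
Proof.
have [[th [/andP[h1 h2] hess <-]] _] := hTh; split.
  by rewrite normr_ge0 ler_norml (ltW h1).
by exists th; rewrite cos_norm.
Qed.

Lemma supp_dichotomy (z : T) : supp mu z ->
  (exists eta : R, `|eta| < Th /\ z = circ eta) \/ z.1 <= cos Th.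
Proof.
move=> hz; have [eta heta ez] := circ_param (supp_circle mu_circ hz).
have [lt|ge] := ltP `|eta| Th; first by left; exists eta.
right; rewrite ez /= -cos_norm; apply: cos_le_pi => //.
by have [/andP[]] := Theta_facts.
Qed.

(* If [Theta = pi], the points accumulating at [-1] would all lie in [S]. *)
Lemma cos_Theta_gtN1 m (x : nat -> R) : (forall i, (i < m)%N -> -1 < x i) ->
  (forall z : T, supp mu z -> (exists eta : R, `|eta| < Th /\ z = circ eta) ->
     exists2 i, (i < m)%N & z.1 = x i) ->
  -1 < cos Th.
Proof.
move=> hx hS; rewrite lt_neqAle cos_geN1 andbT; apply/eqP => hc.
have [/andP[T0 Tpi] [th [hess cth]]] := Theta_facts.
have [g g0 hg] : exists2 g, 0 < g & forall i, (i < m)%N -> g <= x i + 1.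
  apply: finite_common_small; first by move=> i s s' _ ss; apply: le_trans.
  by move=> i im; exists (x i + 1) => //; have := hx i im; lra.
have [w [hw /andP[w1 w2]]] := ess_near hess g0.
rewrite /= cth -hc opprK in w1 w2.
have [hs|] := supp_dichotomy hw.
- have [i im wi] := hS w hw hs; have := hg i im; rewrite -wi.
  by move: w2; rewrite ltr_norml => /andP[]; lra.
- rewrite -hc => h; have cw := supp_circle mu_circ hw.
  have : w.1 + 1 = 0 by apply/eqP; rewrite eq_le; apply/andP; split; nra.
  by move=> e; rewrite e normr0 ltxx in w1.
Qed.

Lemma angles_cvg (phi : nat -> R) :
  (forall i, phi i < phi i.+1) -> (forall i, 0 < phi i < Th) ->
  (forall i, supp mu (circ (phi i))) -> cos (phi i) @[i --> \oo] --> cos Th.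
Proof.
move=> inc hT hs.
have [/andP[T0 Tpi] _] := Theta_facts.
have nd : nondecreasing_seq phi by apply/nondecreasing_seqP => i; exact: ltW.
have ub : has_ubound (range phi).
  by exists Th => _ [i _ <-]; have /andP[_ /ltW] := hT i.
have cphi := nondecreasing_cvgn nd ub.
set L := sup (range phi) in cphi.
have ltL i : phi i < L.
  by rewrite (lt_le_trans (inc i))//; apply: ub_le_sup => //; exists i.+1.
have LT : L <= Th.
  apply: ge_sup; first by exists (phi 0%N); exists 0%N.
  by move=> _ [i _ <-]; have /andP[_ /ltW] := hT i.
have L0 : 0 < L by apply: lt_trans (ltL 0%N); have /andP[] := hT 0%N.
have ccos : cos (phi i) @[i --> \oo] --> cos L.
  by apply: continuous_cvg => //; exact: continuous_cos.
have csin : sin (phi i) @[i --> \oo] --> sin L.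
  by apply: continuous_cvg => //; exact: continuous_sin.
have near e : 0 < e -> exists i, ball (circ L) e (circ (phi i)).
  move=> e0.
  have /cvgrPdist_lt/(_ e e0)[N1 _ h1] := ccos.
  have /cvgrPdist_lt/(_ e e0)[N2 _ h2] := csin.
  exists (maxn N1 N2); split => /=.
  - by apply: h1; rewrite /= leq_maxl.
  - by apply: h2; rewrite /= leq_maxr.
have suppL : supp mu (circ L).
  move=> e e0; have e20 : 0 < e / 2 by rewrite divr_gt0.
  have [i [b1 b2]] := near _ e20.
  apply: lt_le_trans (hs i _ e20) _; apply: le_measure; rewrite ?inE.
  + exact: measurable_prod_ball.
  + exact: measurable_prod_ball.
  move=> w [c1 c2]; rewrite /ball /= in b1 b2 c1 c2; split; rewrite /ball /=.
  - rewrite (_ : _ - w.1 = (cos L - cos (phi i)) + (cos (phi i) - w.1)); last by ring.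
    by apply: le_lt_trans (ler_normD _ _) _; lra.
  - rewrite (_ : _ - w.2 = (sin L - sin (phi i)) + (sin (phi i) - w.2)); last by ring.
    by apply: le_lt_trans (ler_normD _ _) _; lra.
have essL : ess_supp mu (circ L).
  split=> // e e0; have [i hi] := near e e0.
  exists (circ (phi i)); split=> // /(congr1 fst) /= h.
  have /andP[/ltW p0 _] := hT i.
  by have := cos_lt_pi p0 (ltL i) (le_trans LT Tpi); rewrite h ltxx.
have [_ hmin] := hTh.
have : Th <= `|L|.
  apply: hmin => //; rewrite (le_trans LT Tpi) andbT.
  by apply: lt_trans L0; rewrite oppr_lt0 pi_gt0.
rewrite gtr0_norm// => TL.
by have -> : Th = L by apply/eqP; rewrite eq_le TL LT.
Qed.

End Theta.
End CircleGeometry.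

Section Profiles.
Variables (R : realType) (mu : probability (R * R)%type R) (D : set (R * R)%type).
Hypothesis mD : measurable D.
Hypothesis muD : mu (~` D) = 0%E.
Hypothesis Dcirc : forall z, D z -> z.1 ^+ 2 + z.2 ^+ 2 = 1.
Local Notation T := (R * R)%type.

Definition concentrates (w : {poly R}) (k : nat) (y : R) : Prop :=
  forall (p : R -> {poly R}) (C : R),
    (forall t q, 0 <= t -> 0 <= q <= 2 -> `|(p t).[q]| <= C) ->
    (forall t, 0 <= t -> p t \is monic /\ size (p t) = k.+1) ->
    (forall t (r : {poly R}), 0 <= t -> (size r <= k)%N ->
       lapp mu D t (w * p t * r) = 0) ->
    forall e, 0 < e -> exists2 t0, 0 <= t0 & forall t, t0 <= t ->
      lapp mu D t (w * (('X - y%:P) * p t) * (('X - y%:P) * p t))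
        <= e * lapp mu D t (w * p t * p t) /\
      0 < lapp mu D t (w * p t * p t).

Lemma concentratesP (w : {poly R}) (k r : nat) (z : nat -> T) (y : R) :
  (forall q, 0 <= q <= 2 -> 0 <= w.[q] <= 2) ->
  (forall q, 0 < q -> 0 < w.[q]) ->
  (forall q, w.[q] = 0 -> q = 0) ->
  (r <= k)%N -> 0 <= y <= 2 ->
  (forall i, (i < r)%N -> supp mu (z i) /\ 0 < 1 - (z i).1 < y) ->
  (forall i j, (i < r)%N -> (j < r)%N -> i != j -> (z i).1 != (z j).1) ->
  (forall v, D v ->
    [\/ w.[1 - v.1] = 0, (exists2 i, (i < r)%N & v.1 = (z i).1) | y <= 1 - v.1]) ->
  (forall e, 0 < e -> exists Z : nat -> T,
    (forall i, (i <= k)%N -> [/\ supp mu (Z i), 1 - (Z i).1 < y + e & 0 < w.[1 - (Z i).1]]) /\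
    (forall i j, (i < j <= k)%N -> (Z i).1 != (Z j).1)) ->
  concentrates w k y.
Proof.
move=> w02 wpos w0 rk y02 hz zne cover spots p C ple pm po e e0.
have lower e1 : 0 < e1 -> exists2 c, 0 < c &
    forall t p, 0 <= t -> p \is monic -> size p = k.+1 ->
    c * expR (- 2 * t * (y + e1)) <= lapp mu D t (w * p * p).
  move=> e10; have [Z [h1 h2]] := spots e1 e10.
  apply: (lapp_lower mD muD Dcirc _ h1 h2).
  by move=> q /w02/andP[].
have mass i : (i < r)%N -> 0 < fine (mu (atom (1 - (z i).1) `&` D)).
  move=> ir; have [hs /andP[q0 qy]] := hz i ir.
  have [g g0 hg] : exists2 g, 0 < g & forall j, (j < r)%N -> j != i -> g <= `|(z i).1 - (z j).1|.
    apply: (@finite_common_small _ (fun j g => j != i -> g <= `|(z i).1 - (z j).1|)).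
      by move=> j s s' _ ss h ji; apply: le_trans (h ji).
    move=> j jr; have [->|ji] := eqVneq j i; first by exists 1.
    exists `|(z i).1 - (z j).1| => //; rewrite normr_gt0 subr_eq0.
    by apply: zne => //; rewrite eq_sym.
  pose rad := Num.min g (Num.min (1 - (z i).1) (y - (1 - (z i).1))).
  have r0 : 0 < rad by rewrite !lt_min g0 q0 subr_gt0 qy.
  have r1 : rad <= g by rewrite ge_min lexx.
  have r2 : rad <= 1 - (z i).1 by rewrite !ge_min lexx orbT.
  have r3 : rad <= y - (1 - (z i).1) by rewrite !ge_min lexx !orbT.
  apply: (atom_mass mD muD hs r0) => v Dv lt.
  case: (cover v Dv) => [/w0 h|[j jr vj]|yv].
  - by move: lt; rewrite ltr_norml => /andP[]; lra.
  - have [ji|ji] := eqVneq j i; first by rewrite vj ji.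
    have := hg j jr ji; rewrite distrC -vj => h.
    by have := lt_le_trans lt r1; rewrite ltNge h.
  - by move: lt; rewrite ltr_norml => /andP[]; lra.
have Qne i j : (i < r)%N -> (j < r)%N -> i != j -> 1 - (z i).1 != 1 - (z j).1.
  move=> ir jr ij; apply: contra_neq (zne i j ir jr ij) => h.
  by apply: oppr_inj; apply: (addrI 1).
have Qlt i : (i < r)%N -> 1 - (z i).1 < y by move=> ir; have [_ /andP[]] := hz i ir.
have Qw i : (i < r)%N -> 0 < w.[1 - (z i).1].
  by move=> ir; have [_ /andP[/wpos]] := hz i ir.
have cov v : D v -> [\/ w.[1 - v.1] = 0,
    (exists2 i, (i < r)%N & 1 - v.1 = 1 - (z i).1) | y <= 1 - v.1].
  move=> /cover[h|[i ir h]|h]; [exact: Or31|apply: Or32|exact: Or33].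
  by exists i => //; rewrite h.
have [t0 t00 ht0] := concentration mD Dcirc w02 ple pm po rk y02 Qne Qlt Qw mass cov lower e0.
exists t0 => // t tt0; split; first exact: ht0.
have [c c0 hc] := lower 1 ltr01.
have t1 := le_trans t00 tt0; have [pm1 ps1] := pm t t1.
by apply: lt_le_trans (hc t (p t) t1 pm1 ps1); rewrite mulr_gt0// expR_gt0.
Qed.

End Profiles.

Section LimitsAtInfinity.
Variable R : realType.

Lemma cvgy_sqr (b : R -> R) (y : R) :
  (forall e, 0 < e -> exists t0, forall t, t0 <= t -> (b t - y) ^+ 2 <= e) ->
  b t @[t --> +oo] --> y.
Proof.
move=> h; apply/cvgrPdist_le => e e0; have [t0 ht0] := h _ (exprn_gt0 2 e0).
exists t0; split; first exact: num_real.
move=> t /ltW /ht0; rewrite distrC -[X in X <= _]real_normK ?num_real//.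
by rewrite ler_sqr ?nnegrE// ltW.
Qed.

Lemma cvgy_squeeze0 (f g : R -> R) : (forall t, 0 <= f t <= g t) ->
  g t @[t --> +oo] --> (0 : R) -> f t @[t --> +oo] --> (0 : R).
Proof.
move=> fg g0; apply: (squeeze_cvgr _ (cvg_cst 0) g0).
by apply: nearW => t; exact: fg.
Qed.

Section Recover.
Variable a : nat -> R -> R.
Hypothesis a1 : forall n t, -1 < a n t < 1.
Local Notation u n t := (volterra a n t).

Lemma volterra_even k t : u k.*2 t = (1 - a k.*2 t) * (1 - prev_coef a k.*2 t) / 2.
Proof. by rewrite /volterra -signr_odd odd_double expr0 !mul1r. Qed.

Lemma volterra_odd k t : u k.*2.+1 t = (1 + a k.*2.+1 t) * (1 + a k.*2 t) / 2.
Proof. by rewrite /volterra -signr_odd /= odd_double expr1 !mulN1r !opprK. Qed.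

Lemma volterra_gt0 n t : 0 < u n t.
Proof. by have /andP[] := volterra_itv n t a1. Qed.

Lemma recover_even k (p y : R) : p != 1 ->
  prev_coef a k.*2 t @[t --> +oo] --> p -> u k.*2 t @[t --> +oo] --> y ->
  a k.*2 t @[t --> +oo] --> 1 - 2 * y / (1 - p).
Proof.
move=> p1 hp hu.
have E t : a k.*2 t = 1 - 2 * u k.*2 t / (1 - prev_coef a k.*2 t).
  rewrite volterra_even; have : 1 - prev_coef a k.*2 t != 0.
    rewrite gt_eqF// subr_gt0; case: k {hp hu} => [|k] /=; first by rewrite gtrN.
    by have /andP[] := a1 k.*2.+1 t.
  by move=> h; field.
rewrite (eq_cvg _ _ E); apply: cvgB; first exact: cvg_cst.
apply: cvgM; first by apply: cvgM => //; exact: cvg_cst.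
apply: cvgV; first by rewrite subr_eq0 eq_sym.
by apply: cvgB => //; exact: cvg_cst.
Qed.

Lemma recover_odd k (p y : R) : p != -1 ->
  a k.*2 t @[t --> +oo] --> p -> u k.*2.+1 t @[t --> +oo] --> y ->
  a k.*2.+1 t @[t --> +oo] --> 2 * y / (1 + p) - 1.
Proof.
move=> p1 hp hu.
have E t : a k.*2.+1 t = 2 * u k.*2.+1 t / (1 + a k.*2 t) - 1.
  rewrite volterra_odd; have : 1 + a k.*2 t != 0.
    by rewrite gt_eqF//; have /andP[h _] := a1 k.*2 t; lra.
  by move=> h; field.
rewrite (eq_cvg _ _ E); apply: cvgB; last exact: cvg_cst.
apply: cvgM; first by apply: cvgM => //; exact: cvg_cst.
apply: cvgV; first by rewrite addrC addr_eq0.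
by apply: cvgD => //; exact: cvg_cst.
Qed.

Lemma volterra_quot n (y : R) : y != 0 -> u n t @[t --> +oo] --> y ->
  u n.+1 t * u n t @[t --> +oo] --> (0 : R) -> u n.+1 t @[t --> +oo] --> (0 : R).
Proof.
move=> y0 hu hp.
have E t : u n.+1 t = u n.+1 t * u n t * (u n t)^-1.
  by rewrite mulfK// gt_eqF// volterra_gt0.
by rewrite (eq_cvg _ _ E); have := cvgM hp (cvgV y0 hu); rewrite mul0r; exact.
Qed.

Lemma limits_even_first (y : nat -> R) : (forall k, 0 < y k < 2) ->
  (forall k, u k.*2 t + vprev (fun n => u n t) k.*2 @[t --> +oo] --> y k) ->
  (forall k, u k.*2.+1 t * u k.*2 t @[t --> +oo] --> (0 : R)) ->
  forall k, a k.*2 t @[t --> +oo] --> 1 - y k /\ a k.*2.+1 t @[t --> +oo] --> (-1 : R).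
Proof.
move=> y02 hs hp k.
have step j : prev_coef a j.*2 t @[t --> +oo] --> (-1 : R) ->
    vprev (fun n => u n t) j.*2 @[t --> +oo] --> (0 : R) ->
    [/\ a j.*2 t @[t --> +oo] --> 1 - y j, a j.*2.+1 t @[t --> +oo] --> (-1 : R) &
        u j.*2.+1 t @[t --> +oo] --> (0 : R)].
  move=> ha hv; have /andP[y0 y2] := y02 j.
  have hu : u j.*2 t @[t --> +oo] --> y j.
    have E t : u j.*2 t = u j.*2 t + vprev (fun n => u n t) j.*2 - vprev (fun n => u n t) j.*2.
      by rewrite addrK.
    by rewrite (eq_cvg _ _ E); have := cvgB (hs j) hv; rewrite subr0; exact.
  have ha2 : a j.*2 t @[t --> +oo] --> 1 - y j.
    rewrite (_ : 1 - y j = 1 - 2 * y j / (1 - -1)); last by field.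
    by apply: recover_even => //; lra.
  have hu1 : u j.*2.+1 t @[t --> +oo] --> (0 : R).
    by apply: volterra_quot (hp j) => //; [exact: lt0r_neq0 y0|exact: hu].
  split=> //; rewrite (_ : -1 = 2 * 0 / (1 + (1 - y j)) - 1); last by ring.
  by apply: recover_odd => //; lra.
have [//] : [/\ a k.*2 t @[t --> +oo] --> 1 - y k, a k.*2.+1 t @[t --> +oo] --> (-1 : R) &
    u k.*2.+1 t @[t --> +oo] --> (0 : R)].
elim: k => [|k [_ h1 h2]]; first by apply: step; exact: cvg_cst.
exact: step.
Qed.

Lemma limits_odd_first (y : nat -> R) : (forall k, 0 < y k < 2) ->
  u 0 t @[t --> +oo] --> (0 : R) ->
  (forall k, u k.*2.+1 t + u k.*2 t @[t --> +oo] --> y k) ->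
  (forall k, u k.*2.+2 t * u k.*2.+1 t @[t --> +oo] --> (0 : R)) ->
  forall k, a k.*2 t @[t --> +oo] --> (1 : R) /\ a k.*2.+1 t @[t --> +oo] --> y k - 1.
Proof.
move=> y02 h0 hs hp k.
have odd j : a j.*2 t @[t --> +oo] --> (1 : R) -> u j.*2 t @[t --> +oo] --> (0 : R) ->
    a j.*2.+1 t @[t --> +oo] --> y j - 1 /\ u j.*2.+1 t @[t --> +oo] --> y j.
  move=> ha hu; have /andP[y0 y2] := y02 j.
  have hu1 : u j.*2.+1 t @[t --> +oo] --> y j.
    have E t : u j.*2.+1 t = u j.*2.+1 t + u j.*2 t - u j.*2 t by rewrite addrK.
    by rewrite (eq_cvg _ _ E); have := cvgB (hs j) hu; rewrite subr0; exact.
  split=> //; rewrite (_ : y j - 1 = 2 * y j / (1 + 1) - 1); last by field.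
  by apply: recover_odd => //; lra.
suff [h1 h2] : a k.*2 t @[t --> +oo] --> (1 : R) /\ u k.*2 t @[t --> +oo] --> (0 : R).
  by split=> //; have [] := odd k h1 h2.
elim: k => [|k [h1 h2]].
  split=> //; rewrite (_ : 1 = 1 - 2 * 0 / (1 - -1)); last by ring.
  have n1 : (-1 : R) != 1 by rewrite lt_eqF//; lra.
  by apply: (@recover_even 0%N (-1) 0 n1) => //; exact: cvg_cst.
have /andP[y0 y2] := y02 k.
have [h3 h4] := odd k h1 h2.
have hu : u k.+1.*2 t @[t --> +oo] --> (0 : R).
  by apply: volterra_quot (hp k) => //; [exact: lt0r_neq0 y0|exact: h4].
split=> //; rewrite (_ : 1 = 1 - 2 * 0 / (1 - (y k - 1))); last by ring.
by apply: recover_even => //; lra.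
Qed.

Lemma limits_all0 :
  (forall k, u k.*2 t + vprev (fun n => u n t) k.*2 @[t --> +oo] --> (0 : R)) ->
  forall n, a n t @[t --> +oo] --> ((-1) ^+ n : R).
Proof.
move=> hs n.
have vp j t : 0 <= vprev (fun n => u n t) j.
  by case: j => [|j] //=; exact/ltW/volterra_gt0.
have ev k : u k.*2 t @[t --> +oo] --> (0 : R).
  apply: cvgy_squeeze0 (hs k) => t; rewrite lerDl vp andbT.
  exact/ltW/volterra_gt0.
have od k : u k.*2.+1 t @[t --> +oo] --> (0 : R).
  apply: cvgy_squeeze0 (hs k.+1) => t; rewrite lerDr.
  by rewrite !ltW// volterra_gt0.
have step k : prev_coef a k.*2 t @[t --> +oo] --> (-1 : R) ->
    a k.*2 t @[t --> +oo] --> (1 : R) /\ a k.*2.+1 t @[t --> +oo] --> (-1 : R).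
  move=> h.
  have n1 : (-1 : R) != 1 by rewrite lt_eqF//; lra.
  have h1 : a k.*2 t @[t --> +oo] --> (1 : R).
    rewrite (_ : 1 = 1 - 2 * 0 / (1 - -1)); last by ring.
    exact: recover_even n1 h (ev k).
  split=> //; rewrite (_ : -1 = 2 * 0 / (1 + 1) - 1); last by ring.
  by apply: recover_odd h1 (od k); rewrite gt_eqF//; lra.
have all k : a k.*2 t @[t --> +oo] --> (1 : R) /\ a k.*2.+1 t @[t --> +oo] --> (-1 : R).
  elim: k => [|k [_ IH]]; first by apply: step; exact: cvg_cst.
  exact: step.
rewrite -signr_odd -[in a n](odd_double_half n).
by case: odd; have [] := all n./2.
Qed.

End Recover.
End LimitsAtInfinity.

Section FlowLimits.
Variables (R : realType) (mu : probability (R * R)%type R) (D : set (R * R)%type).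
Hypothesis mD : measurable D.
Hypothesis muD : mu (~` D) = 0%E.
Hypothesis Dcirc : forall z, D z -> z.1 ^+ 2 + z.2 ^+ 2 = 1.
Variable a : nat -> R -> R.
Hypothesis a1 : forall n t, -1 < a n t < 1.
Hypothesis flow : schur_flow a.
Hypothesis hver : forall n, verblunsky_is mu n (Complex (a n 0) 0).
Local Notation u n t := (volterra a n t).
Local Notation v t := (fun n => volterra a n t).

Lemma volterra_le2 n t : 0 <= u n t <= 2.
Proof. by have /andP[h1 h2] := volterra_itv n t a1; rewrite !ltW. Qed.

Lemma flow_step0 n t : 0 <= t ->
  lap mu D t (fun q => renorm (v t) n.+1 q - u n t * renorm (v t) n q) = 0.
Proof.
apply: (@lap_step0 R mu D mD Dcirc (fun n t => u n t)).
- exact: volterra_le2.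
- by move=> s; exact: volterra_flow0.
- by move=> m s; exact: volterra_flowS.
- move=> m; rewrite -[RHS](renorm_step_int0 mD muD Dcirc hver m).
  by apply: eq_Rintegral => z _; rewrite mulr0 mul0r expR0 mulr1.
Qed.

Lemma flow_limitsP k y : concentrates mu D 1 k y ->
  (u k.*2 t + vprev (v t) k.*2 @[t --> +oo] --> y) /\
  (u k.*2.+1 t * u k.*2 t @[t --> +oo] --> (0 : R)).
Proof.
move=> hc.
have key e : 0 < e -> exists t0, forall t, t0 <= t ->
    u k.*2.+1 t * u k.*2 t + (u k.*2 t + vprev (v t) k.*2 - y) ^+ 2 <= e.
  move=> e0.
  have [t0 t00 ht0] := hc (fun t => (opPQ (v t) k).1) (8 ^+ k)
     (fun t q _ q02 => (opPQ_le (volterra_le2 ^~ t) k q02).1)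
     (fun t _ => let: And4 h1 h2 _ _ := opPQ_monic (v t) k in conj h1 h2)
     (fun t r tt0 rk => etrans (congr1 (lapp mu D t) (congr1 (fun x => x * r) (mul1r _)))
        (lapp_orth mD Dcirc (fun j jk => (opPQ_orth mD Dcirc (fun n => flow_step0 n tt0) jk).1) rk))
     e e0.
  exists t0 => t tt0; have [h1 h2] := ht0 t tt0.
  have st := fun n => flow_step0 n (le_trans t00 tt0).
  rewrite !mul1r in h1 h2.
  have := varianceP mD Dcirc st k y; rewrite (normPS mD Dcirc st) => h3.
  rewrite -(ler_pM2r h2); apply: le_trans h1; apply: le_trans h3.
  by rewrite mulrDl.
split.
- apply: cvgy_sqr => e /key[t0 ht0]; exists t0 => t /ht0; apply: le_trans.
  by rewrite lerDr mulr_ge0// ltW// volterra_gt0.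
- apply/cvgrPdist_le => e /key[t0 ht0]; exists t0; split; first exact: num_real.
  move=> t /ltW/ht0; rewrite sub0r normrN ger0_norm; last first.
    by rewrite mulr_ge0// ltW// volterra_gt0.
  by apply: le_trans; rewrite lerDl sqr_ge0.
Qed.

Lemma flow_limitsQ k y : concentrates mu D 'X k y ->
  (u k.*2.+1 t + u k.*2 t @[t --> +oo] --> y) /\
  (u k.*2.+2 t * u k.*2.+1 t @[t --> +oo] --> (0 : R)).
Proof.
move=> hc.
have key e : 0 < e -> exists t0, forall t, t0 <= t ->
    u k.*2.+2 t * u k.*2.+1 t + (u k.*2.+1 t + u k.*2 t - y) ^+ 2 <= e.
  move=> e0.
  have [t0 t00 ht0] := hc (fun t => (opPQ (v t) k).2) (8 ^+ k)
     (fun t q _ q02 => (opPQ_le (volterra_le2 ^~ t) k q02).2)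
     (fun t _ => let: And4 _ _ h1 h2 := opPQ_monic (v t) k in conj h1 h2)
     (fun t r tt0 rk =>
        (lapp_orth mD Dcirc (fun j jk => (opPQ_orth mD Dcirc (fun n => flow_step0 n tt0) jk).2) rk))
     e e0.
  exists t0 => t tt0; have [h1 h2] := ht0 t tt0.
  have st := fun n => flow_step0 n (le_trans t00 tt0).
  have := varianceQ mD Dcirc st k y; rewrite (normQS mD Dcirc st) => h3.
  rewrite -(ler_pM2r h2); apply: le_trans h1; apply: le_trans h3.
  by rewrite mulrDl.
split.
- apply: cvgy_sqr => e /key[t0 ht0]; exists t0 => t /ht0; apply: le_trans.
  by rewrite lerDr mulr_ge0// ltW// volterra_gt0.
- apply/cvgrPdist_le => e /key[t0 ht0]; exists t0; split; first exact: num_real.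
  move=> t /ltW/ht0; rewrite sub0r normrN ger0_norm; last first.
    by rewrite mulr_ge0// ltW// volterra_gt0.
  by apply: le_trans; rewrite lerDl sqr_ge0.
Qed.

End FlowLimits.

Section AngleProfiles.
Variables (R : realType) (mu : probability (R * R)%type R) (D : set (R * R)%type).
Hypothesis mD : measurable D.
Hypothesis muD : mu (~` D) = 0%E.
Hypothesis Dcirc : forall z, D z -> z.1 ^+ 2 + z.2 ^+ 2 = 1.
Hypothesis mu_circ : on_circle mu.
Variable Th : R.
Hypothesis hTh : is_Theta mu Th.
Local Notation T := (R * R)%type.

Definition weight_ok (w : {poly R}) : Prop :=
  [/\ forall q, 0 <= q <= 2 -> 0 <= w.[q] <= 2,
      forall q, 0 < q -> 0 < w.[q] & forall q, w.[q] = 0 -> q = 0].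

Lemma weight_ok1 : weight_ok 1.
Proof.
split=> q; rewrite hornerC; [by rewrite ler01 ler1n|by []|].
by move/eqP; rewrite oner_eq0.
Qed.

Lemma weight_okX : weight_ok 'X.
Proof. by split=> q; rewrite hornerX. Qed.

Lemma concentrates_bottom w k : weight_ok w ->
  (forall e, 0 < e -> exists Z : nat -> T,
    (forall i, (i <= k)%N -> [/\ supp mu (Z i), 1 - (Z i).1 < e & 0 < w.[1 - (Z i).1]]) /\
    (forall i j, (i < j <= k)%N -> (Z i).1 != (Z j).1)) ->
  concentrates mu D w k 0.
Proof.
move=> [w1 w2 w3] hZ.
apply: (@concentratesP R mu D mD muD Dcirc w k 0 (fun=> circ 0) 0) => //.
- by rewrite lexx /=.
- by move=> v /(circle_coord_itv Dcirc)/andP[h _]; exact: Or33.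
- by move=> e /hZ[Z [h1 h2]]; exists Z; split=> // i /h1; rewrite add0r.
Qed.

Lemma one_sub_cos_gt0 (x : R) : 0 < x -> x <= pi -> 0 < 1 - cos x.
Proof. by move=> x0 xpi; rewrite subr_gt0 -cos0 cos_lt_pi. Qed.

Lemma one_sub_cos_itv (x : R) : 0 <= 1 - cos x <= 2.
Proof. by have := cos_geN1 x; have := cos_le1 x; lra. Qed.

Lemma concentrates_atom w k (phi : nat -> R) : weight_ok w ->
  (forall i, (i <= k)%N -> supp mu (circ (phi i)) /\ 0 < phi i < Th) ->
  (forall i j, (i < j <= k)%N -> phi i < phi j) ->
  (forall v, D v -> [\/ w.[1 - v.1] = 0,
     (exists2 i, (i < k)%N & v.1 = cos (phi i)) | v.1 <= cos (phi k)]) ->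
  concentrates mu D w k (1 - cos (phi k)).
Proof.
move=> [w1 w2 w3] hphi inc cover.
have [/andP[_ Tpi] _] := Theta_facts hTh.
have itv i : (i <= k)%N -> 0 < phi i /\ phi i <= pi.
  by move=> /hphi[_ /andP[h1 h2]]; split=> //; exact: ltW (lt_le_trans h2 Tpi).
have dec i j : (i < j <= k)%N -> cos (phi j) < cos (phi i).
  move=> /andP[ij jk].
  have [h1 _] := itv i (leq_trans (ltnW ij) jk); have [_ h2] := itv j jk.
  by apply: cos_lt_pi; [exact: ltW|apply: inc; rewrite ij|].
apply: (@concentratesP R mu D mD muD Dcirc w k k (fun i => circ (phi i))) => //.
- exact: one_sub_cos_itv.
- move=> i ik; have [h _] := hphi i (ltnW ik); split=> //=.
  have [h1 h2] := itv i (ltnW ik).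
  by rewrite one_sub_cos_gt0//= ltrD2l ltrN2 dec// ik leqnn.
- move=> i j ik jk; rewrite neq_ltn => /orP[ij|ji] /=.
  + by rewrite gt_eqF// dec// ij ltnW.
  + by rewrite lt_eqF// dec// ji ltnW.
- move=> v /cover[h|h|h]; [exact: Or31|exact: Or32|apply: Or33].
  by rewrite lerD2l lerN2.
- move=> e e0; exists (fun i => circ (phi i)); split=> [i ik|i j h] /=; last first.
    by rewrite gt_eqF// dec.
  have [h _] := hphi i ik; have [h1 h2] := itv i ik; split=> //; last first.
    by apply: w2; exact: one_sub_cos_gt0.
  apply: (@le_lt_trans _ _ (1 - cos (phi k))); last by rewrite ltrDl.
  rewrite lerD2l lerN2; move: ik; rewrite leq_eqVlt => /orP[/eqP -> //|ik].
  by rewrite ltW// dec// ik leqnn.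
Qed.

Lemma concentrates_ess w k m (phi : nat -> R) : weight_ok w -> 0 < Th -> (m <= k)%N ->
  (forall i, (i < m)%N -> supp mu (circ (phi i)) /\ 0 < phi i < Th) ->
  (forall i j, (i < j < m)%N -> phi i < phi j) ->
  (forall v, D v -> [\/ w.[1 - v.1] = 0,
     (exists2 i, (i < m)%N & v.1 = cos (phi i)) | v.1 <= cos Th]) ->
  concentrates mu D w k (1 - cos Th).
Proof.
move=> [w1 w2 w3] T0 mk hphi inc cover.
have [/andP[_ Tpi] [th [hess cth]]] := Theta_facts hTh.
have itv i : (i < m)%N -> 0 < phi i /\ phi i <= pi.
  by move=> /hphi[_ /andP[h1 h2]]; split=> //; exact: ltW (lt_le_trans h2 Tpi).
have dec i j : (i < j < m)%N -> cos (phi j) < cos (phi i).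
  move=> /andP[ij jm].
  have [h1 _] := itv i (ltn_trans ij jm); have [_ h2] := itv j jm.
  by apply: cos_lt_pi; [exact: ltW|apply: inc; rewrite ij|].
apply: (@concentratesP R mu D mD muD Dcirc w k m (fun i => circ (phi i))) => //.
- exact: one_sub_cos_itv.
- move=> i im; have [h /andP[h1 h2]] := hphi i im; split=> //=.
  have [_ h3] := itv i im.
  by rewrite one_sub_cos_gt0//= ltrD2l ltrN2 cos_lt_pi// ltW.
- move=> i j im jm; rewrite neq_ltn => /orP[ij|ji] /=.
  + by rewrite gt_eqF// dec// ij.
  + by rewrite lt_eqF// dec// ji.
- move=> v /cover[h|h|h]; [exact: Or31|exact: Or32|apply: Or33].
  by rewrite lerD2l lerN2.
- move=> e e0.
  have y0 := one_sub_cos_gt0 T0 Tpi.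
  have e10 : 0 < Num.min e (1 - cos Th) by rewrite lt_min e0.
  have [Z [h1 h2]] := ess_spots mu_circ hess e10.
  exists Z; split=> [i _|i j /andP[ij _]]; last exact: h2.
  have [hs] := h1 i; rewrite /= cth lt_min !ltr_norml => /andP[/andP[h3 h4] /andP[h5 h6]].
  by split=> //; [lra|apply: w2; lra].
Qed.

End AngleProfiles.

Unset Implicit Arguments.

Theorem theorem4p5 (R : realType) (a0 : nat -> R)
    (mu : probability (R * R)%type R) (a : nat -> R -> R) (Th : R) :
  (forall n, -1 < a0 n < 1) ->
  on_circle mu -> conj_invariant mu -> infinite_set (supp mu) ->
  (forall n, verblunsky_is mu n (Complex (a0 n) 0)) ->
  (forall n, a n 0 = a0 n) ->
  (forall n t, -1 < a n t < 1) ->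
  schur_flow a ->
  is_Theta mu Th ->
  let S := [set z | supp mu z /\ exists eta : R, `|eta| < Th /\ z = circ eta] in
  [/\
  (* (i) *)
  (ess_supp mu (circ 0) ->
     forall n, a n t @[t --> +oo] --> ((-1) ^+ n : R)),
  (* (ii) *)
  (0 < Th -> ~ supp mu (circ 0) ->
   forall (m : nat) (th : nat -> R),
     (forall j k, (1 <= j)%N -> (j < k)%N -> (k <= m)%N -> th j < th k) ->
     (forall j, (1 <= j <= m)%N -> 0 < th j < Th) ->
     S = [set z | exists j, (1 <= j <= m)%N /\
                   (z = circ (th j) \/ z = circ (- th j))] ->
     let x j := if (j <= m)%N then cos (th j) else cos Th in
     [/\ forall n, a n.*2.+1 t @[t --> +oo] --> (-1 : R),
         forall n, (n < m.+1)%N -> a n.*2 t @[t --> +oo] --> x n.+1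
       & forall n, (m <= n)%N -> a n.*2 t @[t --> +oo] --> x m.+1]),
  (* (iii) *)
  (0 < Th -> ~ supp mu (circ 0) ->
   forall th : nat -> R,
     (forall j, (1 <= j)%N -> th j < th j.+1) ->
     (forall j, (1 <= j)%N -> 0 < th j < Th) ->
     S = [set z | exists j, (1 <= j)%N /\
                   (z = circ (th j) \/ z = circ (- th j))] ->
     [/\ forall n, a n.*2.+1 t @[t --> +oo] --> (-1 : R),
         forall n, a n.*2 t @[t --> +oo] --> cos (th n.+1)
       & cos (th j) @[j --> \oo] --> cos Th]),
  (* (iv) *)
  (0 < Th -> supp mu (circ 0) ->
   forall (m : nat) (th : nat -> R),
     (forall j k, (2 <= j)%N -> (j < k)%N -> (k <= m.+1)%N -> th j < th k) ->
     (forall j, (2 <= j <= m.+1)%N -> 0 < th j < Th) ->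
     S = [set z | z = circ 0 \/ exists j, (2 <= j <= m.+1)%N /\
                   (z = circ (th j) \/ z = circ (- th j))] ->
     let x j := if (j <= m)%N then cos (th j.+1) else cos Th in
     [/\ forall n, a n.*2 t @[t --> +oo] --> (1 : R),
         forall n, (1 <= n < m.+1)%N -> a n.*2.-1 t @[t --> +oo] --> - x n
       & forall n, (m.+1 <= n)%N -> a n.*2.-1 t @[t --> +oo] --> - x m.+1]) &
  (* (v) *)
  (0 < Th -> supp mu (circ 0) ->
   forall th : nat -> R,
     (forall j, (2 <= j)%N -> th j < th j.+1) ->
     (forall j, (2 <= j)%N -> 0 < th j < Th) ->
     S = [set z | z = circ 0 \/ exists j, (2 <= j)%N /\
                   (z = circ (th j) \/ z = circ (- th j))] ->
     let x j := cos (th j.+1) in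
     [/\ forall n, a n.*2 t @[t --> +oo] --> (1 : R),
         forall n, (1 <= n)%N -> a n.*2.-1 t @[t --> +oo] --> - x n
       & x j @[j --> \oo] --> cos Th])
  ].
Proof.
move=> _ mu_circ _ _ hver0 ha0 a1 flow hTh S.
have hver n : verblunsky_is mu n (Complex (a n 0) 0) by rewrite ha0.
have [D [mD muD Dsupp Dcirc]] := full_set mu_circ.
have limP := flow_limitsP mD muD Dcirc a1 flow hver.
have limQ := flow_limitsQ mD muD Dcirc a1 flow hver.
have [/andP[_ Tpi] _] := Theta_facts hTh.
have dich v : supp mu v -> S v \/ v.1 <= cos Th.
  by move=> hv; have [h|h] := supp_dichotomy mu_circ hTh hv; [left|right].
have fst_angle (z : (R * R)%type) x : z = circ x \/ z = circ (- x) -> z.1 = cos x.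
  by move=> [] -> //=; rewrite cosN.
have incr (phi : nat -> R) : (forall i, phi i < phi i.+1) ->
    forall i j, (i < j)%N -> phi i < phi j.
  move=> h i; elim=> // j IH; rewrite ltnS leq_eqVlt => /orP[/eqP -> //|/IH].
  by move/lt_trans; apply.
have y_itv x : 0 < x -> x < Th -> 0 < 1 - cos x < 2.
  move=> x0 xT; rewrite one_sub_cos_gt0// ?(le_trans (ltW xT))//=.
  have := cos_lt_pi (ltW x0) xT Tpi; have := cos_geN1 Th; lra.
have y_Th m (x : nat -> R) : 0 < Th -> (forall i, (i < m)%N -> -1 < x i) ->
    (forall z, S z -> exists2 i, (i < m)%N & z.1 = x i) -> 0 < 1 - cos Th < 2.
  move=> T0 hx hS; rewrite one_sub_cos_gt0//=.
  have := cos_Theta_gtN1 mu_circ hTh hx (fun z hz he => hS z (conj hz he)); lra.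
have u0_lim : supp mu (circ 0) -> volterra a 0 t @[t --> +oo] --> (0 : R).
  move=> h0.
  have [|h _] := limP 0%N 0.
    apply: concentrates_bottom (weight_ok1 R) _ => // e e0.
    exists (fun=> circ 0); split=> [i _|i [|j] /andP[]//].
    by split=> //=; rewrite ?hornerC// cos0 subrr.
  by move: h; under eq_fun do rewrite /= addr0.
split.
- move=> hess; apply: limits_all0 => // k.
  have [|h _] := limP k 0; last exact: h.
  apply: concentrates_bottom (weight_ok1 R) _ => // e e0.
  have [Z [h1 h2]] := ess_spots mu_circ hess e0.
  exists Z; split=> [i _|i j /andP[ij _]]; last exact: h2.
  have [hs] := h1 i; rewrite /circ /= cos0 ltr_norml => /andP[h3 _].
  by split=> //; [lra|rewrite hornerC].
- move=> T0 _ m th inc hth hS x.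
  pose phi i := th i.+1.
  have hphi i : (i < m)%N -> supp mu (circ (phi i)) /\ 0 < phi i < Th.
    move=> im; split; last by apply: hth; rewrite im.
    suff [] : S (circ (phi i)) by [].
    by rewrite hS; exists i.+1; split; [rewrite im|left].
  have Sphi z : S z -> exists2 i, (i < m)%N & z.1 = cos (phi i).
    by rewrite hS => -[j [jm /fst_angle]]; case: j jm => // j jm h; exists j.
  have incphi i j : (i < j < m)%N -> phi i < phi j.
    by move=> /andP[ij jm]; exact: inc.
  pose y k := if (k < m)%N then 1 - cos (phi k) else 1 - cos Th.
  have y02 k : 0 < y k < 2.
    rewrite /y; case: ltnP => km.
      by have [_ /andP[h1 h2]] := hphi k km; exact: y_itv.
    apply: (y_Th m (fun i => cos (phi i))) => // i im.
    by have [_ /andP[h1 h2]] := hphi i im; have := y_itv _ h1 h2; lra.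
  have hc k : concentrates mu D 1 k (y k).
    rewrite /y; case: ltnP => km.
      apply: (concentrates_atom mD muD Dcirc hTh (weight_ok1 R)).
      - by move=> i ik; apply: hphi; exact: leq_ltn_trans km.
      - by move=> i j /andP[ij jk]; apply: incphi; rewrite ij (leq_ltn_trans jk).
      - move=> v /Dsupp/dich[/Sphi[i im h]|h]; last first.
          apply: Or33; apply: le_trans h _; have [_ /andP[h1 h2]] := hphi k km.
          by apply: cos_le_pi => //; exact: ltW.
        have [ik|ki] := ltnP i k; first by apply: Or32; exists i.
        apply: Or33; rewrite h; move: ki; rewrite leq_eqVlt => /orP[/eqP -> //|ki].
        have [_ /andP[h1 _]] := hphi k km; have [_ /andP[_ h2]] := hphi i im.
        apply: cos_le_pi; [exact: ltW|apply: ltW; apply: incphi; rewrite ki|].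
        + exact: im.
        + exact: ltW (lt_le_trans h2 Tpi).
    apply: (concentrates_ess mD muD Dcirc mu_circ hTh (weight_ok1 R) T0 km hphi incphi).
    by move=> v /Dsupp/dich[/Sphi h|h]; [exact: Or32|exact: Or33].
  have lim := limits_even_first a1 y02 (fun k => (limP k (y k) (hc k)).1)
    (fun k => (limP k (y k) (hc k)).2).
  split=> n.
  + by have [] := lim n.
  + move=> _; have [h _] := lim n; move: h; rewrite /y /x /phi.
    by case: ltnP => _; rewrite subKr.
  + move=> mn; have [h _] := lim n; move: h; rewrite /y /x ltnn ltnNge mn /=.
    by rewrite subKr.
- move=> T0 _ th inc hth hS.
  pose phi i := th i.+1.
  have hphi i : supp mu (circ (phi i)) /\ 0 < phi i < Th.
    split; last by apply: hth.
    suff [] : S (circ (phi i)) by [].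
    by rewrite hS; exists i.+1; split=> //; left.
  have Sphi z : S z -> exists i, z.1 = cos (phi i).
    by rewrite hS => -[j [jm /fst_angle]]; case: j jm => // j _ h; exists j.
  have incphi : forall i j, (i < j)%N -> phi i < phi j.
    by apply: incr => i; exact: inc.
  pose y k := 1 - cos (phi k).
  have y02 k : 0 < y k < 2 by have [_ /andP[h1 h2]] := hphi k; exact: y_itv.
  have hc k : concentrates mu D 1 k (y k).
    apply: (concentrates_atom mD muD Dcirc hTh (weight_ok1 R)).
    - by move=> i _.
    - by move=> i j /andP[ij _]; exact: incphi.
    - move=> v /Dsupp/dich[/Sphi[i h]|h]; last first.
        apply: Or33; apply: le_trans h _; have [_ /andP[h1 h2]] := hphi k.
        by apply: cos_le_pi => //; exact: ltW.
      have [ik|ki] := ltnP i k; first by apply: Or32; exists i.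
      apply: Or33; rewrite h; move: ki; rewrite leq_eqVlt => /orP[/eqP -> //|ki].
      have [_ /andP[h1 _]] := hphi k; have [_ /andP[_ h2]] := hphi i.
      apply: cos_le_pi; [exact: ltW|apply: ltW; exact: incphi|].
      exact: ltW (lt_le_trans h2 Tpi).
  have lim := limits_even_first a1 y02 (fun k => (limP k (y k) (hc k)).1)
    (fun k => (limP k (y k) (hc k)).2).
  split=> [n|n|].
  + by have [] := lim n.
  + by have [h _] := lim n; move: h; rewrite /y /phi subKr.
  + have h : cos (phi i) @[i --> \oo] --> cos Th.
      apply: (angles_cvg hTh) => i; first exact: incphi.
      - by have [] := hphi i.
      - by have [] := hphi i.
    rewrite -(cvg_shiftS (fun j => cos (th j))).
    exact h.
- move=> T0 h0 m th inc hth hS x.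
  pose phi i := th i.+2.
  have hphi i : (i < m)%N -> supp mu (circ (phi i)) /\ 0 < phi i < Th.
    move=> im; split; last by apply: hth; exact: im.
    suff [] : S (circ (phi i)) by [].
    by rewrite hS; right; exists i.+2; split; [exact: im|left].
  have Sphi z : S z -> z.1 = 1 \/ exists2 i, (i < m)%N & z.1 = cos (phi i).
    rewrite hS => -[->|[j [jm /fst_angle]]]; first by left; rewrite /circ /= cos0.
    by case: j jm => [//|[//|j]] jm h; right; exists j.
  have incphi i j : (i < j < m)%N -> phi i < phi j.
    by move=> /andP[ij jm]; exact: inc.
  pose y k := if (k < m)%N then 1 - cos (phi k) else 1 - cos Th.
  have y02 k : 0 < y k < 2.
    rewrite /y; case: ltnP => km.
      by have [_ /andP[h1 h2]] := hphi k km; exact: y_itv.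
    apply: (y_Th m.+1 (fun i => if i is j.+1 then cos (phi j) else 1)) => //.
      move=> [|i] im; first by rewrite gtrN.
      by have [_ /andP[h1 h2]] := hphi i im; have := y_itv _ h1 h2; lra.
    by move=> z /Sphi[h|[i im h]]; [exists 0%N|exists i.+1].
  have hc k : concentrates mu D 'X k (y k).
    rewrite /y; case: ltnP => km.
      apply: (concentrates_atom mD muD Dcirc hTh (weight_okX R)).
      - by move=> i ik; apply: hphi; exact: leq_ltn_trans km.
      - by move=> i j /andP[ij jk]; apply: incphi; rewrite ij (leq_ltn_trans jk).
      - move=> v /Dsupp/dich[/Sphi[h|[i im h]]|h].
        + by apply: Or31; rewrite h subrr hornerX.
        + have [ik|ki] := ltnP i k; first by apply: Or32; exists i.
          apply: Or33; rewrite h; move: ki; rewrite leq_eqVlt => /orP[/eqP -> //|ki].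
          have [_ /andP[h1 _]] := hphi k km; have [_ /andP[_ h2]] := hphi i im.
          apply: cos_le_pi; [exact: ltW|apply: ltW; apply: incphi; rewrite ki|].
          * exact: im.
          * exact: ltW (lt_le_trans h2 Tpi).
        + apply: Or33; apply: le_trans h _; have [_ /andP[h1 h2]] := hphi k km.
          by apply: cos_le_pi => //; exact: ltW.
    apply: (concentrates_ess mD muD Dcirc mu_circ hTh (weight_okX R) T0 km hphi incphi).
    move=> v /Dsupp/dich[/Sphi[h|h]|h]; [apply: Or31|exact: Or32|exact: Or33].
    by rewrite h subrr hornerX.
  have lim := limits_odd_first a1 y02 (u0_lim h0) (fun k => (limQ k (y k) (hc k)).1)
    (fun k => (limQ k (y k) (hc k)).2).
  split=> n.
  + by have [] := lim n.
  + case: n => // n /andP[_ nm]; have [_] := lim n; rewrite /y /x ltnS in nm *.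
    by rewrite nm /phi addrAC subrr sub0r.
  + case: n => // n; rewrite ltnS => mn; have [_] := lim n; rewrite /y /x ltnn ltnNge mn /=.
    by rewrite addrAC subrr sub0r.
- move=> T0 h0 th inc hth hS x.
  pose phi i := th i.+2.
  have hphi i : supp mu (circ (phi i)) /\ 0 < phi i < Th.
    split; last by apply: hth.
    suff [] : S (circ (phi i)) by [].
    by rewrite hS; right; exists i.+2; split=> //; left.
  have Sphi z : S z -> z.1 = 1 \/ exists i, z.1 = cos (phi i).
    rewrite hS => -[->|[j [jm /fst_angle]]]; first by left; rewrite /circ /= cos0.
    by case: j jm => [//|[//|j]] jm h; right; exists j.
  have incphi : forall i j, (i < j)%N -> phi i < phi j.
    by apply: incr => i; exact: inc.
  pose y k := 1 - cos (phi k).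
  have y02 k : 0 < y k < 2 by have [_ /andP[h1 h2]] := hphi k; exact: y_itv.
  have hc k : concentrates mu D 'X k (y k).
    apply: (concentrates_atom mD muD Dcirc hTh (weight_okX R)).
    - by move=> i _.
    - by move=> i j /andP[ij _]; exact: incphi.
    - move=> v /Dsupp/dich[/Sphi[h|[i h]]|h].
      + by apply: Or31; rewrite h subrr hornerX.
      + have [ik|ki] := ltnP i k; first by apply: Or32; exists i.
        apply: Or33; rewrite h; move: ki; rewrite leq_eqVlt => /orP[/eqP -> //|ki].
        have [_ /andP[h1 _]] := hphi k; have [_ /andP[_ h2]] := hphi i.
        apply: cos_le_pi; [exact: ltW|apply: ltW; exact: incphi|].
        exact: ltW (lt_le_trans h2 Tpi).
      + apply: Or33; apply: le_trans h _; have [_ /andP[h1 h2]] := hphi k.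
        by apply: cos_le_pi => //; exact: ltW.
  have lim := limits_odd_first a1 y02 (u0_lim h0) (fun k => (limQ k (y k) (hc k)).1)
    (fun k => (limQ k (y k) (hc k)).2).
  split=> [n|n|].
  + by have [] := lim n.
  + case: n => // n _; have [_] := lim n; rewrite /y /x /phi.
    by rewrite addrAC subrr sub0r.
  + have h : cos (phi i) @[i --> \oo] --> cos Th.
      apply: (angles_cvg hTh) => i; first exact: incphi.
      - by have [] := hphi i.
      - by have [] := hphi i.
    rewrite -(cvg_shiftS x).
    exact h.
Qed.
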